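(* Let $\Gamma$ be a countable group with property (BP) and let $\boldsymbol a=\Gamma\curvearrowright^a(Y,\nu)$ be an ergodic measure preserving action of $\Gamma$. Suppose that $\boldsymbol a$ is non-free. Then the stabilizer of $\nu$-almost every $y\in Y$ contains a non-abelian free group. In particular, all groups with property (BP) are shift-minimal.
   Context: A countable group $\Gamma$ has property (BP) if for all $\gamma\in\Gamma\setminus\{e\}$ and $n\ge2$ there exist $\alpha_1,\dots,\alpha_n\in\Gamma$, a subgroup $H\le\Gamma$, and pairwise disjoint subsets $T_1,\dots,T_n\subseteq H$ such that $\alpha_j\gamma\alpha_j^{-1}(H\setminus T_j)\subseteq T_j$ for all $j=1,\dots,n$. A measure preserving (m.p.) action $\boldsymbol a=\Gamma\curvearrowright^a(X,\mu)$ is a Borel action of the countable discrete group $\Gamma$ on a standard probability space (possibly with atoms) preserving $\mu$. It is trivial if $\mu$ is a point mass, non-trivial otherwise. It is free if $\mu(\{x:\gamma^a x=x\})=0$ for every $\gamma\in\Gamma\setminus\{e\}$. The stabilizer of $y$ is $\{\gamma\in\Gamma:\gamma^ay=y\}$. For m.p. actions $\boldsymbol a=\Gamma\curvearrowright^a(X,\mu)$ and $\boldsymbol b=\Gamma\curvearrowright^b(Y,\nu)$, $\boldsymbol a$ is weakly contained in $\boldsymbol b$ if for all Borel $A_1,\dots,A_n\subseteq X$, finite $F\subseteq\Gamma$ and $\epsilon>0$ there are Borel $B_1,\dots,B_n\subseteq Y$ with $|\mu(\gamma^aA_i\cap A_j)-\nu(\gamma^bB_i\cap B_j)|<\epsilon$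 for all $\gamma\in F$, $i,j\le n$. The Bernoulli shift $\boldsymbol s_\Gamma$ is the m.p. action of $\Gamma$ on $([0,1]^\Gamma,\lambda^\Gamma)$ ($\lambda$ Lebesgue measure) given by $(\gamma f)(\delta)=f(\gamma^{-1}\delta)$. $\Gamma$ is shift-minimal if every non-trivial m.p. action of $\Gamma$ weakly contained in $\boldsymbol s_\Gamma$ is free. *)

(* Defs.v *)
From HB Require Import structures.
From mathcomp Require Import all_boot all_order all_algebra finmap.
From mathcomp Require Import all_classical all_reals all_analysis.

Set Implicit Arguments.
Unset Strict Implicit.
Unset Printing Implicit Defensive.

Import Order.TTheory GRing.Theory Num.Theory.

Local Open Scope classical_set_scope.
Local Open Scope ring_scope.

Definition is_subgroup (G : groupType) (H : set G) : Prop :=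
  group_closed (mem H).

Definition property_BP (G : groupType) : Prop :=
  forall gamma : G, gamma <> 1%g -> forall n : nat, (2 <= n)%N ->
  exists (alpha : 'I_n -> G) (H : set G) (T : 'I_n -> set G),
    [/\ is_subgroup H,
        forall j, T j `<=` H,
        trivIset setT T &
        forall j,
          (fun h => alpha j * gamma * (alpha j)^-1 * h)%g @` (H `\` T j)
            `<=` T j].

(** The word [(s1, e1); ...; (sk, ek)] stands for s1^(+-1) ... sk^(+-1), the
    sign being + when ei is true. *)
Definition word_val (G : groupType) (w : seq (G * bool)) : G :=
  (\prod_(l <- w) (if l.2 then l.1 else l.1^-1))%g.

Definition reduced (G : groupType) (w : seq (G * bool)) : bool :=
  sorted (fun l m => ~~ ((l.1 == m.1) && (l.2 != m.2))) w.

Definition word_over (G : groupType) (S : set G) (w : seq (G * bool)) : Prop :=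
  forall l, l \in w -> S l.1.

Definition free_basis (G : groupType) (S K : set G) : Prop :=
  K = (@word_val G) @` word_over S /\
  forall w, word_over S w -> reduced w -> w <> [::] -> word_val w <> 1%g.

Definition is_free_subgroup (G : groupType) (K : set G) : Prop :=
  exists S : set G, free_basis S K.

Definition contains_nonabelian_free (G : groupType) (H : set G) : Prop :=
  exists K : set G, [/\ K `<=` H, is_free_subgroup K &
    exists x y, [/\ K x, K y & ~ commute x y]].

(** The measurable structure of T is the Borel structure of a Polish topology
    (carried over along a bijection f). *)
Definition standard_borel (R : realType) d (T : measurableType d) : Prop :=
  exists (P : completePseudoMetricType R) (f : T -> P),
    [/\ hausdorff_space P,
        (exists2 D : set P, countable D & dense D),
        bijective f &
        @measurable d T = preimage_set_system setT f <<s @open P >>].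

Record mp_action (G : groupType) (R : realType) d (X : measurableType d)
    (mu : probability X R) := MpAction {
  act :> G -> X -> X ;
  act1 : forall x, act 1%g x = x ;
  actM : forall g h x, act (g * h)%g x = act g (act h x) ;
  measurable_act : forall g, measurable_fun setT (act g) ;
  act_preserves : forall g A, measurable A -> mu (act g @^-1` A) = mu A
}.

Section actions.
Context (G : groupType) (R : realType) d (X : measurableType d)
  (mu : probability X R).
Implicit Type a : mp_action G mu.

Definition ergodic a : Prop :=
  forall A : set X, measurable A -> (forall g, a g @^-1` A = A) ->
    mu A = 0%E \/ mu A = 1%E.

Definition is_free a : Prop :=
  forall g : G, g <> 1%g -> mu [set x | a g x = x] = 0%E.

Definition is_trivial a : Prop :=
  exists x : X, forall A, measurable A -> mu A = \d_x A :> \bar R.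

Definition stabilizer a (x : X) : set G := [set g | a g x = x].

End actions.

Definition weakly_contained (G : groupType) (R : realType)
    d (X : measurableType d) (mu : probability X R) (a : mp_action G mu)
    d' (Y : measurableType d') (nu : probability Y R) (b : mp_action G nu) :=
  forall (n : nat) (A : 'I_n -> set X) (F : set G) (eps : R),
    (forall i, measurable (A i)) -> finite_set F -> 0 < eps ->
  exists B : 'I_n -> set Y, (forall i, measurable (B i)) /\
    forall g, F g -> forall i j,
      `|fine (mu (a g @` A i `&` A j)) - fine (nu (b g @` B i `&` B j))| < eps.

Definition unit_itv (R : realType) : Type := {x : R | x \in `[0, 1]}.
HB.instance Definition _ (R : realType) := Choice.on (unit_itv R).

Definition unit_val (R : realType) (x : unit_itv R) :
  measurableTypeR R := val x.

Definition unit_itv_display : measure_display.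
Proof. exact: default_measure_display. Qed.

Section unit_itv_measurable.
Context (R : realType).

Let zero_in_unit : (0 : R) \in `[0, 1].
Proof. by rewrite in_itv /= lexx ler01. Qed.

HB.instance Definition _ := isPointed.Build (unit_itv R)
  (exist _ 0 zero_in_unit).

Let trace := g_sigma_algebra_preimageType (@unit_val R).

Let borel := g_sigma_algebra_preimage (@unit_val R).

Let borel0 : borel set0.
Proof. exact: (@measurable0 _ trace). Qed.

Let borelC A : borel A -> borel (~` A).
Proof. exact: (@measurableC _ trace). Qed.

Let borel_bigcup (F : (set (unit_itv R))^nat) :
  (forall i, borel (F i)) -> borel (\bigcup_i F i).
Proof. exact: (@bigcupT_measurable _ trace). Qed.

HB.instance Definition _ := @isMeasurable.Build unit_itv_display (unit_itv R)
  borel borel0 borelC borel_bigcup.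

End unit_itv_measurable.

Definition unit_lebesgue (R : realType) (A : set (unit_itv R)) : \bar R :=
  lebesgue_measure (@unit_val R @` A).

Definition configs (G : groupType) (R : realType) : Type := G -> unit_itv R.

Definition configs_display : measure_display.
Proof. exact: default_measure_display. Qed.

Section configs_measurable.
Context (G : groupType) (R : realType).

HB.instance Definition _ := Pointed.copy (configs G R) (G -> unit_itv R).

Let product_sigma : set (set (configs G R)) :=
  <<s \bigcup_(g in [set: G])
        preimage_set_system setT (fun f : configs G R => f g) measurable >>.

Let product_sigma0 : product_sigma set0.
Proof. exact: sigma_algebra0. Qed.

Let product_sigmaC A : product_sigma A -> product_sigma (~` A).
Proof. exact: sigma_algebraC. Qed.

Let product_sigma_bigcup (F : (set (configs G R))^nat) :
  (forall i, product_sigma (F i)) -> product_sigma (\bigcup_i F i).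
Proof. exact: sigma_algebra_bigcup. Qed.

HB.instance Definition _ := @isMeasurable.Build configs_display (configs G R)
  product_sigma product_sigma0 product_sigmaC product_sigma_bigcup.

End configs_measurable.

Definition cylinder (G : groupType) (R : realType) (s : {fset G})
    (A : G -> set (unit_itv R)) : set (configs G R) :=
  [set f | forall g, g \in s -> A g (f g)].

(** P is the product measure lambda^G, lambda the Lebesgue measure on [0, 1]:
    by Kolmogorov's theorem there is exactly one such P. *)
Definition is_product_measure (G : groupType) (R : realType)
    (P : probability (configs G R) R) : Prop :=
  forall (s : {fset G}) (A : G -> set (unit_itv R)),
    (forall g, measurable (A g)) ->
    P (cylinder s A) = (\prod_(g <- s) unit_lebesgue (A g))%E.

Definition shift (G : groupType) (R : realType) (g : G) (f : configs G R) :
  configs G R := fun h => f (g^-1 * h)%g.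

Section bernoulli.
Context (G : groupType) (R : realType).
Implicit Types (s : {fset G}) (A B : G -> set (unit_itv R)).

Let cylinders : set (set (configs G R)) :=
  [set C | exists s A, (forall g, measurable (A g)) /\ C = cylinder s A].

Let measurable_eval (g : G) (B : set (unit_itv R)) :
  measurable B -> measurable [set f : configs G R | B (f g)].
Proof.
move=> mB; apply: sub_sigma_algebra; exists g => //.
by exists B => //; rewrite setTI.
Qed.

Let measurable_cylinder s A :
  (forall g, measurable (A g)) -> measurable (cylinder s A).
Proof.
move=> mA.
have -> : cylinder s A =
    \bigcap_(g in [set` s]) [set f : configs G R | A g (f g)].
  by apply/seteqP; split => f.
apply: fin_bigcap_measurable; first exact: finite_fset.
by move=> g _; exact: measurable_eval.
Qed.

Let measurable_cylinders :
  @measurable _ (configs G R) = <<s cylinders >>.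
Proof.
apply/seteqP; split.
  apply: smallest_sub; first exact: smallest_sigma_algebra.
  move=> _ [g _ [B mB <-]]; apply: sub_sigma_algebra.
  exists [fset g]%fset, (fun=> B); split=> //.
  apply/seteqP; split => f /=.
    by move=> [_ Bf] h; rewrite inE => /eqP ->.
  by move=> /(_ g); rewrite inE eqxx => /(_ isT).
apply: smallest_sub; first exact: sigma_algebra_measurable.
by move=> _ [s [A [mA ->]]]; exact: measurable_cylinder.
Qed.

Let setI_cylinders : setI_closed cylinders.
Proof.
move=> _ _ [s [A [mA ->]]] [t [B [mB ->]]].
exists (s `|` t)%fset, (fun g => (if g \in s then A g else setT) `&`
                               (if g \in t then B g else setT)); split.
  by move=> g; apply: measurableI; case: ifP.
apply/seteqP; split => f /=.
  by move=> [Af Bf] g _; split; case: ifP => // gs; [exact: Af|exact: Bf].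
move=> H; split => g gs.
  by have [] := H g; rewrite ?inE gs.
by have [] := H g; rewrite ?inE gs ?orbT.
Qed.

Lemma measurable_shift (g : G) : measurable_fun setT (@shift G R g).
Proof.
apply: (@measurability _ _ _ (configs G R) _ _ _ (erefl _)).
move=> _ [_ [h _ [B mB <-]] <-]; rewrite !setTI.
exact: (measurable_eval (g^-1 * h)%g mB).
Qed.

Lemma shift_cylinder (g : G) s A :
  @shift G R g @^-1` cylinder s A =
  cylinder [fset (g^-1 * h)%g | h in s]%fset (fun h => A (g * h)%g).
Proof.
apply/seteqP; split => f /=.
  by move=> Af _ /imfsetP[h /= hs ->]; rewrite mulVKg; exact: Af.
move=> Af h hs; have /= := Af (g^-1 * h)%g.
by rewrite mulVKg; apply; apply/imfsetP; exists h.
Qed.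

Lemma shift_preserves (P : probability (configs G R) R) :
  is_product_measure P ->
  forall (g : G) (C : set (configs G R)), measurable C ->
    P (@shift G R g @^-1` C) = P C.
Proof.
move=> HP g C mC; pose mg := measurable_shift g.
have cT : cylinders setT.
  exists fset0, (fun=> setT); split=> //.
  by apply/seteqP; split.
unshelve epose (m1 := pushforward P (@shift G R g) :
  {measure set (configs G R) -> \bar R}).
  exact: mg.
apply: (measure_unique cylinders (fun=> setT) _ _ _ _ m1 P) => //=.
- by rewrite bigcup_const.
- move=> _ [s [A [mA ->]]]; rewrite /m1 /pushforward/= shift_cylinder !HP//.
  rewrite big_imfset//=; last by move=> h k _ _ /mulgI.
  by apply: eq_bigr => h _; rewrite mulVKg.
- by move=> _; rewrite /m1 /pushforward/= probability_setT ltry.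
Qed.

Lemma shift1 (f : configs G R) : shift 1%g f = f.
Proof. by apply/funext => h; rewrite /shift invg1 mul1g. Qed.

Lemma shiftM (g h : G) (f : configs G R) :
  shift (g * h)%g f = shift g (shift h f).
Proof. by apply/funext => k; rewrite /shift invgM mulgA. Qed.

Definition bernoulli_shift (P : probability (configs G R) R)
    (HP : is_product_measure P) : mp_action G P :=
  MpAction shift1 shiftM measurable_shift (shift_preserves HP).

End bernoulli.

Definition shift_minimal (G : groupType) (R : realType) : Prop :=
  forall (P : probability (configs G R) R) (HP : is_product_measure P)
    (d : measure_display) (X : measurableType d) (mu : probability X R),
    standard_borel R X ->
  forall a : mp_action G mu,
    ~ is_trivial a -> weakly_contained a (bernoulli_shift HP) -> is_free a.

(* Main.v *)
Require Import Defs.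
From mathcomp Require Import all_boot all_order all_algebra finmap.
From mathcomp Require Import all_classical all_reals all_analysis.
From mathcomp Require Import ring lra.

(** If [gamma <> 1] fixes a set of measure [c > 0], then so does each of its
    conjugates [g_j]; with more than [k / c] of them, some [k + 1] of their fixed
    sets meet in positive measure.  Property (BP) makes the [g_j] play ping-pong on
    [G]: there are disjoint sets [T_j] with [g_j (G \ T_j)] inside [T_j].  Four such
    elements give the free pair [g_0 g_1], [g_2 g_3] in the stabilizers of the points
    of a set of positive measure, and ergodicity spreads this to almost every point.

    For shift-minimality, let three ping-pong elements fix a set [A] of positive
    measure pointwise, in an action weakly contained in the Bernoulli shift.  The
    subsets of [A] then produce almost invariant sets [B] in the shift, which may be
    assumed to depend on finitely many coordinates.  The Efron-Stein decomposition
    [1_B = sum_S f_S] over finite sets [S] of coordinates is equivariant, so spreading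
    [|f_S|^2], for [S] nonempty, evenly over [S] gives an almost invariant measure on
    [G] of total mass [Var 1_B].  Each [T_j] carries about half of that mass or more,
    and there are three of them, so [Var 1_B] is about 0.  Hence every measurable
    subset of [A], and then every measurable set, has measure 0 or 1, and on a standard
    Borel space such a measure is a point mass. *)

Set Implicit Arguments.
Unset Strict Implicit.
Unset Printing Implicit Defensive.
Import Order.TTheory GRing.Theory Num.Theory.
Local Open Scope classical_set_scope.
Local Open Scope ring_scope.

(** * Efron-Stein energies *)

Section averaging.
Context (R : realFieldType) (G : eqType) (W : finType) (p : W -> R).
Implicit Types (x y z : G -> W) (i j : G) (l L S : seq G) (f u v : (G -> W) -> R).

Definition upd x i (a : W) : G -> W := fun j => if j == i then a else x j.

(** The conditional expectation given all coordinates but [i], for independent letters of law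
    [p]. *)
Definition avg i f : (G -> W) -> R := fun x => \sum_a p a * f (upd x i a).

Fixpoint avgs l f := if l is i :: l' then avgs l' (avg i f) else f.

Definition supp (Q : pred G) f := forall x y, (forall i, Q i -> x i = y i) -> f x = f y.

(* The recursion branches over the sets [S] of coordinates of [l] at which [1 - avg i] is
   applied, [avg i] being applied at the others: the leaves carry the components of the
   Efron-Stein decomposition of [f], and their squared norms are summed with weights [w S]. *)
Fixpoint energy (w : seq G -> R) L x l S f : R :=
  if l is i :: l' then
    energy w L x l' S (avg i f) + energy w L x l' (i :: S) (f \- avg i f)
  else w S * avgs L (fun y => f y ^+ 2) x.

Lemma updC x i j a b : i != j -> upd (upd x i a) j b = upd (upd x j b) i a.
Proof.
move=> ij; apply/funext => k; rewrite /upd; case: (eqVneq k i) => // ->.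
by rewrite (negbTE ij).
Qed.

Lemma updK x i a b : upd (upd x i a) i b = upd x i b.
Proof. by apply/funext => k; rewrite /upd; case: eqP. Qed.

Lemma avgC i j f : avg i (avg j f) = avg j (avg i f).
Proof.
have [->//|ij] := eqVneq i j; apply/funext => x; rewrite /avg.
under eq_bigr do rewrite mulr_sumr.
rewrite exchange_big /=; apply: eq_bigr => b _.
rewrite mulr_sumr; apply: eq_bigr => a _.
by rewrite mulrCA (updC _ _ _ ij).
Qed.

Lemma avgsC l i f : avgs l (avg i f) = avg i (avgs l f).
Proof. by elim: l f => //= j l IH f; rewrite avgC IH. Qed.

Lemma avgs_avgsC l L f : avgs l (avgs L f) = avgs L (avgs l f).
Proof. by elim: l f => //= j l IH f; rewrite -avgsC IH. Qed.

Lemma avg_lin i c f u :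
  avg i (fun x => c * f x + u x) = (fun x => c * avg i f x + avg i u x).
Proof.
apply/funext => x; rewrite /avg mulr_sumr -big_split /=.
by apply: eq_bigr => a _; rewrite mulrDr mulrCA.
Qed.

Lemma avgs_lin l c f u :
  avgs l (fun x => c * f x + u x) = (fun x => c * avgs l f x + avgs l u x).
Proof. by elim: l f u => //= i l IH f u; rewrite avg_lin IH. Qed.

Lemma avg0 i : avg i (fun=> 0) = (fun=> 0).
Proof. by apply/funext => x; rewrite /avg big1// => a _; rewrite mulr0. Qed.

Lemma avgs0 l : avgs l (fun=> 0) = (fun=> 0).
Proof. by elim: l => //= i l IH; rewrite avg0. Qed.

Lemma avgsZ l c f : avgs l (fun x => c * f x) = (fun x => c * avgs l f x).
Proof.
transitivity (avgs l (fun x => c * f x + (fun=> 0) x)).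
  by congr avgs; apply/funext => x; rewrite addr0.
by rewrite avgs_lin avgs0; apply/funext => x; rewrite addr0.
Qed.

Lemma avgs_sum (I : finType) l (c : I -> R) (F : I -> (G -> W) -> R) :
  avgs l (fun x => \sum_a c a * F a x) = (fun x => \sum_a c a * avgs l (F a) x).
Proof.
suff H (r : seq I) : avgs l (fun x => \sum_(a <- r) c a * F a x) =
    (fun x => \sum_(a <- r) c a * avgs l (F a) x) by exact: H.
elim: r => [|a r IH].
  under eq_fun do rewrite big_nil.
  by rewrite avgs0; apply/funext => x; rewrite big_nil.
under eq_fun do rewrite big_cons.
by rewrite avgs_lin IH; apply/funext => x; rewrite big_cons.
Qed.

Lemma avgB i f u : avg i (f \- u) = avg i f \- avg i u.
Proof.
have -> : f \- u = (fun x => -1 * u x + f x).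
  by apply/funext => x /=; rewrite mulN1r addrC.
by rewrite avg_lin; apply/funext => x /=; rewrite mulN1r addrC.
Qed.

Lemma avgD i f u : avg i (f \+ u) = avg i f \+ avg i u.
Proof.
have -> : f \+ u = (fun x => 1 * f x + u x) by apply/funext => x /=; rewrite mul1r.
by rewrite avg_lin; apply/funext => x /=; rewrite mul1r.
Qed.

Lemma supp_avg Q i f : supp Q f -> supp (fun j => (j != i) && Q j) (avg i f).
Proof.
move=> Hf x y xy; apply: eq_bigr => a _; congr (_ * _); apply: Hf => j Qj.
by rewrite /upd; case: eqVneq => // ji; apply: xy; rewrite ji.
Qed.

Lemma sub_supp (Q Q' : pred G) f : (forall i, Q i -> Q' i) -> supp Q f -> supp Q' f.
Proof. by move=> QQ' Hf x y xy; apply: Hf => i /QQ'; exact: xy. Qed.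

Lemma supp_avg_sub Q i f : supp Q f -> supp Q (avg i f).
Proof. by move/(@supp_avg _ i); apply: sub_supp => j /andP[]. Qed.

Lemma supp_avgs Q l f : supp Q f -> supp (fun j => (j \notin l) && Q j) (avgs l f).
Proof.
elim: l Q f => [|i l IH] Q f /= Hf; first exact: sub_supp Hf.
apply: sub_supp (IH _ _ (@supp_avg _ i _ Hf)) => j.
by rewrite inE negb_or => /and3P[-> -> ->].
Qed.

Lemma energyDw w w' L x l S f :
  energy (fun S => w S + w' S) L x l S f = energy w L x l S f + energy w' L x l S f.
Proof. by elim: l S f => [|i l IH] S f /=; rewrite ?mulrDl// !IH addrACA. Qed.

Lemma energy_eqw w w' L x l S f :
  w =1 w' -> energy w L x l S f = energy w' L x l S f.
Proof. by move=> ww'; congr energy; exact/funext. Qed.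

Lemma avg_inj (h : G -> G) i f : injective h ->
  avg (h i) (fun x => f (x \o h)) = (fun x => avg i f (x \o h)).
Proof.
move=> hI; apply/funext => x; apply: eq_bigr => a _; congr (_ * f _).
by apply/funext => j; rewrite /upd /= (inj_eq hI).
Qed.

Lemma avgs_inj (h : G -> G) l f : injective h ->
  avgs (map h l) (fun x => f (x \o h)) = (fun x => avgs l f (x \o h)).
Proof. by move=> hI; elim: l f => //= i l IH f; rewrite avg_inj. Qed.

(** Equivariance of the decomposition: relabelling coordinates along [h] carries the component at
    [S] to the one at [map h S]. It is applied to left translations of the group. *)
Lemma energy_inj (h : G -> G) w L x l S f : injective h ->
  energy w (map h L) x (map h l) (map h S) (fun y => f (y \o h)) =
  energy (fun S => w (map h S)) L (x \o h) l S f.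
Proof.
move=> hI; elim: l S f => [|i l IH] S f /=.
  by rewrite (avgs_inj _ (fun y => f y ^+ 2) hI).
by rewrite -!IH avg_inj.
Qed.

Hypothesis p1 : \sum_a p a = 1.

Lemma avg_id Q i f : supp Q f -> ~~ Q i -> avg i f = f.
Proof.
move=> Hf Qi; apply/funext => x; rewrite /avg -[RHS]mul1r -p1 mulr_suml.
apply: eq_bigr => a _; congr (_ * _); apply: Hf => j Qj.
by rewrite /upd; case: eqVneq => // ji; rewrite -ji Qj in Qi.
Qed.

Lemma avg_idem i f : avg i (avg i f) = avg i f.
Proof.
apply/funext => x; rewrite {1}/avg -[RHS]mul1r -p1 mulr_suml.
by apply: eq_bigr => a _; congr (_ * _); apply: eq_bigr => b _; rewrite updK.
Qed.

(** [avg i f] does not depend on coordinate [i], so [avg i] treats it as a constant. *)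
Lemma avg_pull i f u : avg i (fun x => avg i f x * u x) = (fun x => avg i f x * avg i u x).
Proof.
apply/funext => x; rewrite /avg mulr_sumr; apply: eq_bigr => a _.
by rewrite mulrCA; congr (_ * _); apply: eq_bigr => b _; rewrite updK.
Qed.

Lemma avgs_absorb l i f : i \in l -> avgs l (avg i f) = avgs l f.
Proof.
elim: l f => //= j l IH f; rewrite inE => /predU1P[->|il]; first by rewrite avg_idem.
by rewrite avgC IH.
Qed.

Lemma avgs_const l c : avgs l (fun=> c) = (fun=> c).
Proof. by elim: l => //= i l IH; rewrite (@avg_id pred0). Qed.

(* Both sides are constant functions, and the two averages commute. *)
Lemma avgs_supp (Q : pred G) L L' f x y : supp Q f ->
  {subset Q <= L} -> {subset Q <= L'} -> avgs L f x = avgs L' f y.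
Proof.
move=> Hf QL QL'.
have cst K z : {subset Q <= K} -> avgs K f = (fun=> avgs K f z).
  move=> QK; apply/funext => t; apply: (supp_avgs (l := K) Hf) => i /andP[iK Qi].
  by rewrite (QK _ Qi) in iK.
have : avgs L (avgs L' f) = avgs L' (avgs L f) by exact: avgs_avgsC.
by rewrite (cst L x)// (cst L' y)// !avgs_const => /(congr1 (@^~ x)).
Qed.

(** Every leaf function still depends only on [Q], so averaging its square over a list containing
    [Q] gives a constant: the list and the base point are immaterial. *)
Lemma energy_supp (Q : pred G) w L L' x y l S f : supp Q f ->
  {subset Q <= L} -> {subset Q <= L'} ->
  energy w L x l S f = energy w L' y l S f.
Proof.
move=> Hf QL QL'; elim: l S f Hf => [|i l IH] S f Hf /=.
  congr (_ * _); apply: (avgs_supp _ _ _ QL QL') => z t zt.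
  by rewrite (Hf _ _ zt).
have Hi := supp_avg_sub i Hf.
congr (_ + _); apply: IH => // z t zt /=.
by rewrite (Hf _ _ zt) (Hi _ _ zt).
Qed.

Lemma energy0 w L x l S : energy w L x l S (fun=> 0) = 0.
Proof.
elim: l S => [|i l IH] S /=.
  by under eq_fun do rewrite expr0n /=; rewrite avgs0 mulr0.
rewrite avg0 IH add0r -[RHS](IH (i :: S)); congr energy.
by apply/funext => y /=; rewrite subr0.
Qed.

(** Where [avg i f = f], the branch of [f \- avg i f] carries the zero function and contributes
    nothing. *)
Lemma energy_fixed w L x l l' S f : (forall i, i \in l -> avg i f = f) ->
  energy w L x (l ++ l') S f = energy w L x l' S f.
Proof.
elim: l => //= i l IH H; rewrite H ?mem_head// IH; last first.
  by move=> j jl; rewrite H// inE jl orbT.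
rewrite (_ : f \- f = (fun=> 0)) ?energy0 ?addr0//.
by apply/funext => y /=; rewrite subrr.
Qed.

Lemma energy_perm_acc w L x l S S' f :
  (forall S S', perm_eq S S' -> w S = w S') -> perm_eq S S' ->
  energy w L x l S f = energy w L x l S' f.
Proof.
move=> Hw; elim: l S S' f => [|i l IH] S S' f SS' /=; first by rewrite (Hw _ _ SS').
by congr (_ + _); apply: IH; rewrite ?perm_cons.
Qed.

(** The averages commute, so splitting at two coordinates in either order gives the same four
    branches. Only the order of the entries of [S] changes, and [w] ignores it. *)
Lemma energy_swap w L x i l l' S f :
  (forall S S', perm_eq S S' -> w S = w S') ->
  energy w L x (l ++ i :: l') S f = energy w L x (i :: l ++ l') S f.
Proof.
move=> Hw; elim: l S f => //= j l IH S f; rewrite !IH /= !avgB avgC.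
rewrite addrACA; congr (_ + _ + (_ + _)).
rewrite (@energy_perm_acc _ _ _ _ _ [:: j, i & S])//; last first.
  by rewrite -[[:: i, j & S]]/([:: i] ++ [:: j] ++ S) perm_catCA.
congr energy; apply/funext => y /=; rewrite (avgC j i).
ring.
Qed.

Lemma energy_perm w L x l l' S f :
  (forall S S', perm_eq S S' -> w S = w S') -> perm_eq l l' ->
  energy w L x l S f = energy w L x l' S f.
Proof.
move=> Hw; elim: l l' S f => [|i l IH] l' S f ll'.
  by move: ll'; rewrite perm_sym => /perm_nilP ->.
have il' : i \in l' by rewrite -(perm_mem ll') mem_head.
move: ll'; case/splitPr: il' => l1 l2 ll'.
have ll12 : perm_eq l (l1 ++ l2).
  by rewrite -(perm_cons i); apply: perm_trans ll' _; rewrite -[i :: l2]cat1s perm_catCA.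
by rewrite energy_swap//=; congr (_ + _); exact: IH.
Qed.

(** After reordering, the coordinates outside [s] come first, and there averaging fixes [f]. *)
Lemma energy_restrict w L x l (s : seq G) f :
  (forall S S', perm_eq S S' -> w S = w S') -> uniq l -> uniq s ->
  supp [in s] f -> {subset s <= l} ->
  energy w L x l [::] f = energy w L x s [::] f.
Proof.
move=> Hw ul us Hf sl.
rewrite (@energy_perm _ _ _ _ ([seq i <- l | i \notin s] ++ s))//; last first.
  apply: uniq_perm => //.
    rewrite cat_uniq filter_uniq//= us andbT; apply/hasPn => i /= si.
    by rewrite mem_filter /= si.
  move=> i; rewrite mem_cat mem_filter; case: (boolP (i \in s)) => //= [/sl->//|_].
  by rewrite orbF.
by apply: energy_fixed => i; rewrite mem_filter => /andP[/= si _]; exact: avg_id Hf si.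
Qed.

(** [avg i] is an orthogonal projection: by [avg_pull], the inner product of [avg i f] with [f] is
    the squared norm of [avg i f]. *)
Lemma avgs_pythagoras L i f x : i \in L ->
  avgs L (fun y => f y ^+ 2) x =
  avgs L (fun y => avg i f y ^+ 2) x + avgs L (fun y => (f \- avg i f) y ^+ 2) x.
Proof.
move=> iL.
have E : avgs L (fun y => avg i f y * f y) = avgs L (fun y => avg i f y ^+ 2).
  by rewrite -(avgs_absorb _ iL) avg_pull.
have -> : (fun y => (f \- avg i f) y ^+ 2) =
    (fun y => -2 * (avg i f y * f y) + (1 * avg i f y ^+ 2 + f y ^+ 2)).
  by apply/funext => y /=; ring.
by rewrite !avgs_lin E; ring.
Qed.

(** Parseval's identity, from Pythagoras at each branching. *)
Lemma energy1 L x l S f : {subset l <= L} ->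
  energy (fun=> 1) L x l S f = avgs L (fun y => f y ^+ 2) x.
Proof.
elim: l S f => [|i l IH] S f /= lL; first by rewrite mul1r.
rewrite !IH; try by move=> j jl; apply: lL; rewrite inE jl orbT.
by rewrite -avgs_pythagoras// lL// mem_head.
Qed.

(** Only the leaf at which every coordinate has been averaged out has [S] empty; for [l] containing
    the support of [f] it carries the squared mean. *)
Lemma energy_nil L x l f :
  energy (fun S => (S == [::])%:R) L x l [::] f = avgs L (fun y => avgs l f y ^+ 2) x.
Proof.
have E0 k S u : S != [::] -> energy (fun S => (S == [::])%:R) L x k S u = 0.
  elim: k S u => [|i k IH] S u /= S0; first by rewrite (negbTE S0) mul0r.
  by rewrite !IH// addr0.
elim: l f => [|i l IH] f /=; first by rewrite ?eqxx mulr1n mul1r.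
by rewrite (E0 _ [:: i])// addr0 IH.
Qed.

Hypothesis p0 : forall a, 0 <= p a.

Lemma avgs_ge0 l f x : (forall y, 0 <= f y) -> 0 <= avgs l f x.
Proof.
elim: l f => //= i l IH f f0; apply: IH => y.
by apply: sumr_ge0 => a _; rewrite mulr_ge0.
Qed.

Lemma ler_avgs l f u x : (forall y, f y <= u y) -> avgs l f x <= avgs l u x.
Proof.
move=> fu; rewrite -subr_ge0 addrC -mulN1r.
have := avgs_ge0 l (f := fun y => -1 * f y + u y) x; rewrite avgs_lin; apply => y.
by rewrite mulN1r addrC subr_ge0.
Qed.

Lemma ler_energy w w' L x l S f :
  (forall S, w S <= w' S) -> energy w L x l S f <= energy w' L x l S f.
Proof.
move=> ww'; elim: l S f => [|i l IH] S f /=; last by rewrite lerD.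
by rewrite ler_wpM2r// avgs_ge0// => y; rewrite sqr_ge0.
Qed.

(** Weighted energies are continuous in [L^2]: write [f ^ 2 - u ^ 2 = (f + u) * (f - u)] and apply
    the weighted inequality of arithmetic and geometric means with parameter [t]. *)
Lemma energy_lipschitz w L x l S f u (t : R) :
  (forall S, 0 <= w S <= 1) -> 0 < t -> {subset l <= L} ->
  energy w L x l S f - energy w L x l S u <=
  t / 2 * avgs L (fun y => (f \+ u) y ^+ 2) x + (2 * t)^-1 * avgs L (fun y => (f \- u) y ^+ 2) x.
Proof.
(* By Parseval the right-hand side becomes a sum over the same leaves, so the bound can be proved
   leaf by leaf. *)
move=> w01 t0 lL; rewrite -!(energy1 x S _ lL).
elim: l S f u {lL} => [|i l IH] S f u /=; last first.
  rewrite opprD [leLHS]addrACA avgD avgB !mulrDr [leRHS]addrACA.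
  apply: lerD; first exact: IH.
  apply: le_trans (IH _ _ _) _; rewrite le_eqVlt; apply/orP; left; apply/eqP.
  congr (_ * energy _ _ _ _ _ _ + _ * energy _ _ _ _ _ _); apply/funext => y /=; ring.
have /andP[w0 w1] := w01 S.
rewrite !mul1r -mulrBr.
set A := avgs _ _ _ - _.
set B := _ + _.
suff [AB B0] : A <= B /\ 0 <= B.
  by rewrite (le_trans (ler_wpM2l w0 AB))// -[leRHS]mul1r ler_wpM2r.
have -> : B = avgs L (fun y => t / 2 * (f y + u y) ^+ 2 + (2 * t)^-1 * (f y - u y) ^+ 2) x.
  by rewrite avgs_lin avgsZ.
have -> : A = avgs L (fun y => -1 * u y ^+ 2 + f y ^+ 2) x.
  by rewrite avgs_lin /A mulN1r addrC.
split; last first.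
  by apply: avgs_ge0 => y; rewrite addr_ge0// mulr_ge0 ?sqr_ge0// ?invr_ge0; lra.
apply: ler_avgs => y.
rewrite -subr_ge0.
have -> : t / 2 * (f y + u y) ^+ 2 + (2 * t)^-1 * (f y - u y) ^+ 2 -
   (-1 * u y ^+ 2 + f y ^+ 2) = (2 * t)^-1 * (t * (f y + u y) - (f y - u y)) ^+ 2.
  by field; rewrite gt_eqF.
by rewrite mulr_ge0 ?sqr_ge0// invr_ge0; lra.
Qed.

End averaging.

(** * Weights on finite sets of coordinates *)

Section weights.
Context (R : realFieldType) (G : eqType).
Implicit Types (Q : pred G) (S : seq G).

(* [energy p (frac Q)] spreads the energy of each Efron-Stein component evenly over its
   set [S] of coordinates and collects what falls on [Q]. *)
Definition frac Q S : R := (count Q S)%:R / (size S)%:R.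

Lemma frac_ge0_le1 Q S : 0 <= frac Q S <= 1.
Proof.
rewrite /frac divr_ge0//=; case: S => [|i S]; first by rewrite mul0r.
by rewrite ler_pdivrMr ?ltr0n// mul1r ler_nat count_size.
Qed.

Lemma frac_perm Q S S' : perm_eq S S' -> frac Q S = frac Q S'.
Proof. by move=> SS'; rewrite /frac (perm_size SS') (permP SS'). Qed.

Lemma frac_map (h : G -> G) Q S : frac Q (map h S) = frac (Q \o h) S.
Proof. by rewrite /frac count_map size_map. Qed.

Lemma sub_frac Q Q' S : (forall i, Q i -> Q' i) -> frac Q S <= frac Q' S.
Proof.
by move=> QQ'; rewrite /frac ler_wpM2r// ?invr_ge0// ler_nat sub_count.
Qed.

(** For [S] empty both fractions are 0, because [0^-1 = 0]; the third term restores the total 1. *)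
Lemma fracC Q S : frac Q S + frac (predC Q) S + (S == [::])%:R = 1.
Proof.
rewrite /frac -mulrDl -natrD count_predC; case: S => [|i S] /=.
  by rewrite mul0r add0r.
by rewrite divff ?addr0// pnatr_eq0.
Qed.

(** Disjointness lets each entry of [S] be counted at most once. *)
Lemma sum_frac_le1 n (Q : 'I_n -> pred G) S :
  (forall j k i, Q j i -> Q k i -> j = k) ->
  \sum_j frac (Q j) S + (S == [::])%:R <= 1.
Proof.
move=> QQ; rewrite /frac -mulr_suml -natr_sum.
case: S => [|i S]; first by rewrite /= invr0 mulr0 add0r.
rewrite addr0 ler_pdivrMr ?ltr0n// mul1r ler_nat.
elim: {i S} (i :: S) => [|i S IH]; first by rewrite /= big1.
rewrite /= big_split /= -add1n leq_add//.
have [/existsP[j Qj]|/existsPn N] := boolP [exists j, Q j i].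
  rewrite (bigD1 j)//= Qj big1// => k kj; case: (boolP (Q k i)) => // Qk.
  by rewrite (QQ _ _ _ Qk Qj) eqxx in kj.
by rewrite big1// => j _; rewrite (negbTE (N j)).
Qed.

End weights.

Lemma energy_sum (R : realFieldType) (G : eqType) (W : finType) (p : W -> R)
  (I : finType) (w : I -> seq G -> R) L x l S f :
  energy p (fun S => \sum_i w i S) L x l S f = \sum_i energy p (w i) L x l S f.
Proof.
elim: l S f => [|i l IH] S f /=; first by rewrite mulr_suml.
by rewrite !IH big_split.
Qed.

(** * The spectral gap estimate *)

(** The configuration of property (BP) with the whole group in place of [H]. *)
Definition pingpong (G : groupType) n (g : 'I_n -> G) (T : 'I_n -> set G) :=
  trivIset setT T /\ forall j h, ~ T j h -> T j (g j * h)%g.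

(** Here [u] is an indicator of mean [b], almost invariant under the [g j]. Its energies form a
    measure on the group of total mass [b - b ^ 2], in which each of three disjoint sets has almost
    half of the mass or more; so this mass is small. *)
Lemma spectral_gap (R : realFieldType) (G : groupType) (W : finType) (p : W -> R)
    (g : 'I_3 -> G) (T : 'I_3 -> set G) (s L : seq G) (a : W)
    (u : (G -> W) -> R) (t d b : R) :
  \sum_a p a = 1 -> (forall a, 0 <= p a) -> pingpong g T ->
  uniq s -> uniq L -> {subset s <= L} ->
  (forall j i, i \in s -> (g j * i)%g \in L) ->
  supp [in s] u -> (forall x, u x = 0 \/ u x = 1) -> 0 < t ->
  (forall j, avgs p L (fun x => (u (x \o *%g (g j)) - u x) ^+ 2) (fun=> a) <= d) ->
  avgs p L u (fun=> a) = b -> b - b ^+ 2 <= 6 * t + 3 * d / (2 * t).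
Proof.
move=> p1 p0 [Tdisj gT] us uL sL gsL Hu u01 t0 Hd Hb.
set x := (fun=> a) : G -> W in Hd Hb.
pose Q j i := `[< T j i >].
pose M Q f := energy p (frac R Q) L x L [::] f.
have uu : (fun y => u y ^+ 2) = u.
  by apply/funext => y; case: (u01 y) => ->; rewrite ?expr0n ?expr1n.
have Hnil : energy p (fun S => (S == [::])%:R) L x L [::] u = b ^+ 2.
  rewrite energy_nil.
  have -> : (fun y => avgs p L u y ^+ 2) = (fun=> b ^+ 2).
    by apply/funext => y; rewrite -Hb; congr (_ ^+ 2); exact: (avgs_supp p1 _ _ Hu).
  by rewrite avgs_const.
have H1 : energy p (fun=> 1) L x L [::] u = b by rewrite energy1// uu.
(* The components with [S] nonempty have total energy [b - b ^ 2], the variance of [u]. *)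
have MC Q' : M Q' u + M (predC Q') u = b - b ^+ 2.
  apply: (addIr (b ^+ 2)); rewrite subrK -[in LHS]Hnil -H1 -!energyDw.
  by apply: energy_eqw => S; exact: fracC.
have Msum : \sum_j M (Q j) u <= b - b ^+ 2.
  rewrite -(lerD2r (b ^+ 2)) subrK -[in leLHS]Hnil -[leRHS]H1 -energy_sum -energyDw.
  apply: ler_energy => // S; apply: sum_frac_le1 => j k i /asboolP ji /asboolP ki.
  by apply: (Tdisj j k) => //; exists i.
(* Translation moves the coordinates from [s] to [g j * s]. Both sides are first cut down to these
   lists, which lie in [L], and then compared by equivariance. *)
have Mshift j Q' : M (Q' \o *%g (g j)) u = M Q' (fun y => u (y \o *%g (g j))).
  rewrite /M (energy_restrict p1 _ _ (@frac_perm _ _ _) uL us Hu sL).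
  have Hgu : supp [in map ( *%g (g j)) s] (fun y => u (y \o *%g (g j))).
    by move=> y z yz; apply: Hu => i si; apply: yz; exact: map_f.
  have gsL' : {subset map ( *%g (g j)) s <= L}.
    by move=> _ /mapP[i si ->]; exact: gsL.
  rewrite (energy_restrict p1 _ _ (@frac_perm _ _ _) uL _ Hgu gsL'); last first.
    by rewrite map_inj_uniq//; exact: mulgI.
  rewrite (energy_supp p1 _ x x _ _ Hgu gsL' (fun i => id)).
  rewrite (energy_supp p1 _ x x _ _ Hu sL (fun i => id)).
  rewrite (energy_inj _ _ _ _ _ [::] _ (@mulgI _ (g j))).
  by apply: energy_eqw => S; rewrite frac_map.
(* As [g j] sends the complement of [T j] into [T j], the mass off [T j] is at most the mass on
   [T j] of the translated function, which exceeds [M (Q j) u] by at most [2 * t + d / (2 * t)]. The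
   term [2 * t] comes from the bound 4 on the square of a sum of two indicators. *)
have Mj j : b - b ^+ 2 - (2 * t + d / (2 * t)) <= 2 * M (Q j) u.
  have le1 : M (predC (Q j)) u <= M (Q j) (fun y => u (y \o *%g (g j))).
    rewrite -Mshift; apply: ler_energy => // S; apply: sub_frac => i.
    by move=> /= /asboolP Ti; apply/asboolP; exact: gT.
  have := energy_lipschitz p1 p0 x [::] (fun y => u (y \o *%g (g j))) u
    (frac_ge0_le1 R (Q j)) t0 (fun i => @id (i \in L)).
  rewrite -/(M _ _) -/(M (Q j) u).
  set A := avgs p L _ _; set B := avgs p L _ _.
  have A4 : A <= 4.
    have -> : 4 = avgs p L (fun=> 4) x by rewrite (avgs_const p1).
    apply: (ler_avgs p0) => y /=.
    by case: (u01 y) => ->; case: (u01 (y \o *%g (g j))) => ->; lra.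
  have t2 : 0 < (2 * t)^-1 by rewrite invr_gt0; lra.
  have := ler_wpM2l (ltW t2) (Hd j); rewrite -/B => Bd.
  have : t / 2 * A <= t / 2 * 4 by rewrite ler_wpM2l//; lra.
  have := MC (Q j); rewrite (mulrC d); lra.
(* Summed over the three disjoint sets, the lower bounds give [3 * (v - r) <= 2 * v] for the
   variance [v] and the error [r], hence [v <= 3 * r]. *)
have : 3 * (b - b ^+ 2 - (2 * t + d / (2 * t))) <= 2 * \sum_j M (Q j) u.
  rewrite mulr_sumr mulr_natl -[X in _ *+ X](card_ord 3) -sumr_const.
  by apply: ler_sum => j _; exact: Mj.
have -> : 3 * d / (2 * t) = 3 * (d / (2 * t)) by rewrite mulrA.
lra.
Qed.

(** * Approximation in the Bernoulli shift *)

Section prob.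
Context (R : realType) d (T : measurableType d) (P : probability T R).
Implicit Types A B C : set T.

Definition pr A : R := fine (P A).

Lemma prE A : measurable A -> P A = (pr A)%:E.
Proof. by move=> mA; rewrite fineK// fin_num_measure. Qed.

Lemma pr_ge0 A : 0 <= pr A.
Proof. by rewrite fine_ge0. Qed.

Lemma pr0 : pr set0 = 0.
Proof. by rewrite /pr measure0. Qed.

Lemma le_pr A B : measurable A -> measurable B -> A `<=` B -> pr A <= pr B.
Proof. by move=> mA mB AB; rewrite -lee_fin -!prE// le_measure ?inE. Qed.

Lemma pr_le1 A : measurable A -> pr A <= 1.
Proof. by move=> mA; rewrite -lee_fin -prE// probability_le1. Qed.

Lemma prUE A B : measurable A -> measurable B ->
  pr (A `|` B) + pr (A `&` B) = pr A + pr B.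
Proof.
move=> mA mB; apply: EFin_inj; rewrite !EFinD -!prE//;
  [|exact: measurableI|exact: measurableU].
rewrite measureUfinr//; last by rewrite ltey_eq fin_num_measure.
by rewrite subeK// fin_num_measure//; exact: measurableI.
Qed.

Lemma prU_le A B : measurable A -> measurable B -> pr (A `|` B) <= pr A + pr B.
Proof. by move=> mA mB; rewrite -prUE// lerDl pr_ge0. Qed.

Lemma prU A B : measurable A -> measurable B -> A `&` B = set0 ->
  pr (A `|` B) = pr A + pr B.
Proof. by move=> mA mB AB; rewrite -prUE// AB pr0 addr0. Qed.

Lemma prDI A B : measurable A -> measurable B -> pr A = pr (A `\` B) + pr (A `&` B).
Proof.
move=> mA mB; rewrite -prU; [by rewrite setUC setUIDK|..].
- exact: measurableD.
- exact: measurableI.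
- by apply/seteqP; split => x //= -[[_ nB] [_]].
Qed.

Lemma measurableY A B : measurable A -> measurable B -> measurable (A `+` B).
Proof. by move=> mA mB; rewrite setY_def; apply: measurableU; exact: measurableD. Qed.

Lemma prY A B : measurable A -> measurable B ->
  pr (A `+` B) = pr A + pr B - 2 * pr (A `&` B).
Proof.
move=> mA mB; rewrite setY_def prU; last 3 first.
- exact: measurableD.
- exact: measurableD.
- by apply/seteqP; split => x //= -[[? ?] [? ?]].
rewrite (prDI mA mB) (prDI mB mA) [B `&` A]setIC; lra.
Qed.

Lemma negligible_pr A : measurable A -> P.-negligible A <-> pr A = 0.
Proof.
move=> mA; split; first by move/(negligibleP _ mA); rewrite /pr => ->.
by move=> A0; apply/(negligibleP _ mA); have := prE mA; rewrite A0.
Qed.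

Lemma prC A : measurable A -> pr (~` A) = 1 - pr A.
Proof.
move=> mA; apply: EFin_inj; rewrite EFinB -!prE//; last exact: measurableC.
exact: probability_setC.
Qed.

Lemma prY_triangle B A C : measurable A -> measurable B -> measurable C ->
  pr (A `+` C) <= pr (A `+` B) + pr (B `+` C).
Proof.
move=> mA mB mC; apply: le_trans (prU_le _ _); try exact: measurableY.
apply: le_pr; [exact: measurableY|by apply: measurableU; exact: measurableY|].
move=> x; rewrite !setY_def /=.
by have [Bx|Bx] := pselect (B x); move=> [[Ax Cx]|[Cx Ax]]; [right|left|left|right]; tauto.
Qed.

Lemma pr_partition (W : finType) (f : T -> W) B : measurable B ->
  (forall a, measurable [set x | f x = a]) ->
  pr B = \sum_a pr (B `&` [set x | f x = a]).
Proof.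
move=> mB mf.
suff H (r : seq W) : uniq r -> measurable [set x | f x \in r] /\
    pr (B `&` [set x | f x \in r]) = \sum_(a <- r) pr (B `&` [set x | f x = a]).
  have [_] := H _ (index_enum_uniq W); rewrite (_ : [set x | _] = setT) ?setIT//.
  by apply/seteqP; split => x //= _; rewrite mem_index_enum.
elim: r => [_|a r IH /= /andP[ar /IH[mr Er]]].
  have -> : [set x | f x \in [::]] = set0 by apply/seteqP; split.
  by split => //; rewrite big_nil setI0 pr0.
have -> : [set x | f x \in a :: r] = [set x | f x = a] `|` [set x | f x \in r].
  apply/seteqP; split => x /=; first by rewrite inE => /orP[/eqP|]; [left|right].
  by move=> [->|xr]; rewrite inE ?eqxx// xr orbT.
split; first exact: measurableU.
rewrite setIUr prU ?big_cons ?Er//; try exact: measurableI.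
apply/seteqP; split => x //= -[[_ fa] [_]]; rewrite fa => ar'.
by rewrite ar' in ar.
Qed.

(** The sets approximable from the algebra form a sigma-algebra: by continuity from below a
    countable union is close to a finite one, and finite unions are approximated term by term. *)
Lemma approx_algebra (Alg : set (set T)) :
  Alg `<=` measurable -> Alg set0 -> (forall A, Alg A -> Alg (~` A)) ->
  (forall A B, Alg A -> Alg B -> Alg (A `|` B)) ->
  forall B, <<s Alg >> B -> forall e, 0 < e -> exists2 A, Alg A & pr (B `+` A) < e.
Proof.
move=> mAlg Alg0 AlgC AlgU.
pose approx B := measurable B /\ forall e, 0 < e -> exists2 A, Alg A & pr (B `+` A) < e.
suff H : <<s Alg >> `<=` approx by move=> B /H[].
apply: smallest_sub; last first.
  move=> A AA; split; first exact: mAlg.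
  by move=> e e0; exists A => //; rewrite setYK pr0.
have approxU A B : approx A -> approx B -> approx (A `|` B).
  move=> [mA HA] [mB HB]; split; first exact: measurableU.
  move=> e e0; have [A' AA' Ae] := HA (e / 2) (divr_gt0 e0 (ltr0Sn _ 1)).
  have [B' AB' Be] := HB (e / 2) (divr_gt0 e0 (ltr0Sn _ 1)).
  exists (A' `|` B'); first exact: AlgU.
  have mA' := mAlg _ AA'; have mB' := mAlg _ AB'.
  apply: (@le_lt_trans _ _ (pr ((A `+` A') `|` (B `+` B')))).
    apply: le_pr; [apply: measurableY; exact: measurableU|apply: measurableU; exact: measurableY|].
    by move=> x; rewrite !setY_def /=; tauto.
  apply: le_lt_trans (prU_le _ _) _; try exact: measurableY.
  by rewrite [e]splitr ltrD.
split.
- by split => // e e0; exists set0 => //; rewrite setYK pr0.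
- move=> A [mA HA]; rewrite setTD; split; first exact: measurableC.
  move=> e e0; have [A' AA' Ae] := HA e e0.
  exists (~` A'); first exact: AlgC.
  suff -> : ~` A `+` ~` A' = A `+` A' by [].
  rewrite !setY_def; apply/seteqP; split => x /=;
    by case: (pselect (A x)); case: (pselect (A' x)); tauto.
- move=> F HF; have mF n : measurable (F n) := (HF n).1.
  have mU := bigcupT_measurable _ mF.
  split => // e e0.
  pose U n := \big[setU/set0]_(i < n.+1) F i.
  have aU n : approx (U n).
    rewrite /U; elim: n => [|n IH]; first by rewrite big_ord1.
    by rewrite big_ord_recr /=; exact: approxU.
  have mUn n : measurable (U n) := (aU n).1.
  have cU : \bigcup_n U n = \bigcup_n F n by exact: bigcup_bigsetU_bigcup.
  have ndU : {homo U : n m / (n <= m)%N >-> (n <= m)%O}.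
    by move=> n m nm; apply/subsetPset; exact: subset_bigsetU.
  have : (P \o U) n @[n --> \oo] --> (pr (\bigcup_n F n))%:E.
    by rewrite -prE// -cU; apply: nondecreasing_cvg_mu => //; rewrite cU.
  move=> /fine_cvgP[_] /cvgrPdist_lt.
  move=> /(_ (e / 2) (divr_gt0 e0 (ltr0Sn _ 1)))[n _ /(_ n (leqnn n))].
  rewrite /= -/(pr (U n)) => Un.
  have [A AA Ae] := (aU n).2 (e / 2) (divr_gt0 e0 (ltr0Sn _ 1)).
  exists A => //; apply: (le_lt_trans (prY_triangle mU (mUn n) (mAlg _ AA))).
  rewrite [e]splitr ltrD//; apply: le_lt_trans Un.
  have UF : U n `<=` \bigcup_n F n by rewrite -cU; exact: bigcup_sup.
  rewrite prY// setIidr// (_ : _ + _ - _ = pr (\bigcup_n F n) - pr (U n)); last by lra.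
  exact: ler_norm.
Qed.

End prob.

(** * Events depending on finitely many coordinates *)

Section patterns.
Context (G : groupType) (R : realType) (P : probability (configs G R) R).
Implicit Types (s : {fset G}) (A : G -> set (unit_itv R)) (l L : seq G).

Lemma measurable_coord i (B : set (unit_itv R)) : measurable B ->
  measurable [set x : configs G R | B (x i)].
Proof.
move=> mB; apply: sub_sigma_algebra; exists i => //.
by exists B => //; rewrite setTI.
Qed.

Lemma measurable_cyl s A :
  (forall g, measurable (A g)) -> measurable (cylinder s A).
Proof.
move=> mA.
have -> : cylinder s A = \bigcap_(g in [set` s]) [set f : configs G R | A g (f g)].
  by apply/seteqP; split => f.
apply: fin_bigcap_measurable; first exact: finite_fset.
by move=> g _; exact: measurable_coord.
Qed.

Definition with_coord i (B : set (unit_itv R)) A g := if g == i then B else A g.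

Lemma measurable_with_coord i B A : measurable B -> (forall g, measurable (A g)) ->
  forall g, measurable (with_coord i B A g).
Proof. by move=> mB mA g; rewrite /with_coord; case: eqP. Qed.

Lemma cylinder_cons i s A B : i \notin s ->
  cylinder s A `&` [set x | B (x i)] = cylinder (i |` s)%fset (with_coord i B A).
Proof.
move=> isn; apply/seteqP; split => x /=.
  move=> [Ax xi] g; rewrite !inE /with_coord => /orP[/eqP->|gs]; first by rewrite eqxx.
  case: eqP => [gi|_]; last exact: Ax.
  by rewrite -gi gs in isn.
move=> H; split; last by have := H i; rewrite !inE eqxx /with_coord eqxx; exact.
move=> g gs; have := H g; rewrite !inE gs orbT /with_coord => /(_ isT).
by case: eqP => // gi; rewrite -gi gs in isn.
Qed.

Section fixed_alphabet.
Context (W : finType) (phi : unit_itv R -> W).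
Hypothesis mphi : forall a, measurable (phi @^-1` [set a]).
Implicit Types D : set (G -> W).

(** Reading each coordinate through the finite-valued map [phi] reduces configurations to words over
    a finite alphabet, where integrals are the finite sums of [avgs]. *)
Definition pattern D : set (configs G R) := [set x | D (fun g => phi (x g))].

(** The law of one letter, read at coordinate [1%g]; under a product measure it is the same at every
    coordinate. *)
Definition mass (a : W) : R := pr P [set x : configs G R | phi (x 1%g) = a].

Lemma measurable_letter i a : measurable [set x : configs G R | phi (x i) = a].
Proof. exact: measurable_coord (mphi a). Qed.

Lemma mass_ge0 a : 0 <= mass a.
Proof. exact: pr_ge0. Qed.

Lemma sum_mass : \sum_a mass a = 1.
Proof.
have -> : 1 = pr P setT by rewrite /pr probability_setT.
rewrite (pr_partition _ measurableT (measurable_letter 1%g)).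
by apply: eq_bigr => a _; rewrite setTI.
Qed.

Lemma supp_split D i l : supp [in i :: l] (\1_D : _ -> R) -> forall a,
  supp [in l] (\1_[set z | D (upd z i a)] : _ -> R).
Proof.
move=> HD a y z yz; rewrite !indicE.
have := HD (upd y i a) (upd z i a); rewrite !indicE; apply => j.
by rewrite /= inE /upd; case: eqVneq => //= _; exact: yz.
Qed.

Lemma pattern_letter D i a :
  pattern D `&` [set x : configs G R | phi (x i) = a] =
  pattern [set z | D (upd z i a)] `&` [set x : configs G R | phi (x i) = a].
Proof.
apply/seteqP; split => x /= [Dx xi]; split => //; move: Dx; rewrite /pattern /=;
  congr D; apply/funext => j; rewrite /upd /=; case: eqP => // ->; by rewrite xi.
Qed.

Lemma supp_nil D : supp [in [::]] (\1_D : _ -> R) -> D = set0 \/ D = setT.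
Proof.
move=> HD; have [->|/set0P[z Dz]] := eqVneq D set0; [by left|right].
apply/seteqP; split => // y _; have := HD y z; rewrite !indicE (mem_set Dz).
case: (boolP (y \in D)) => [/set_mem//|_] /(_ (fun=> ltac:(by []))) /eqP.
by rewrite eq_sym oner_eq0.
Qed.

(** Fixing the letters at the coordinates of [l] one by one leaves an event that depends on no
    coordinate, and each step is a finite union over the alphabet. *)
Lemma measurable_pattern D l : supp [in l] (\1_D : _ -> R) -> measurable (pattern D).
Proof.
elim: l D => [|i l IH] D HD.
  by case: (supp_nil HD) => ->; [exact: measurable0|exact: measurableT].
have -> : pattern D = \bigcup_(a in [set: W]) (pattern D `&` [set x : configs G R | phi (x i) = a]).
  apply/seteqP; split => x; first by move=> Dx; exists (phi (x i)).
  by move=> [a _ []].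
apply: fin_bigcup_measurable => // a _; rewrite pattern_letter.
by apply: measurableI (measurable_letter i a); exact: IH (supp_split HD a).
Qed.

Hypothesis HP : is_product_measure P.

Lemma pr_cyl_cons i s A a : i \notin s -> (forall g, measurable (A g)) ->
  pr P (cylinder s A `&` [set x : configs G R | phi (x i) = a]) = mass a * pr P (cylinder s A).
Proof.
move=> isn mA; rewrite (cylinder_cons _ (phi @^-1` [set a]) isn).
have mA' := measurable_with_coord i (mphi a) mA.
apply: EFin_inj; rewrite EFinM /mass.
have -> : [set x : configs G R | phi (x 1%g) = a] =
    cylinder [fset 1%g]%fset (fun=> phi @^-1` [set a]).
  apply/seteqP; split => x /=; first by move=> x1 g; rewrite inE => /eqP->.
  by move=> /(_ 1%g); rewrite inE eqxx => /(_ isT).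
rewrite -!prE; [|exact: measurable_cyl..].
rewrite !HP// big_fsetU1//= big_seq_fset1 /with_coord eqxx; congr (_ * _)%E.
rewrite !big_seq; apply: eq_bigr => g gs; case: eqP => // gi.
by rewrite -gi gs in isn.
Qed.

(** The cylinder is what makes the induction on [l] work: splitting along the letter at [i] moves
    [i] from [l] into [s], and independence of the new coordinate yields the factor [mass a]. *)
Lemma pr_cyl_pattern (x0 : G -> W) l D s A : uniq l -> supp [in l] (\1_D : _ -> R) ->
  (forall i, i \in l -> i \notin s) -> (forall g, measurable (A g)) ->
  pr P (cylinder s A `&` pattern D) = pr P (cylinder s A) * avgs mass l \1_D x0.
Proof.
elim: l D s A => [|i l IH] D s A.
  move=> _ /supp_nil[]->  _ mA; rewrite /= indicE ?in_set0 ?in_setT.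
    by rewrite (_ : pattern set0 = set0)// setI0 pr0 mulr0.
  by rewrite (_ : pattern setT = setT)// setIT mulr1.
move=> /= /andP[il ul] HD ls mA.
have isn : i \notin s by apply: ls; rewrite mem_head.
rewrite (pr_partition _ _ (measurable_letter i)); last first.
  by apply: measurableI; [exact: measurable_cyl|exact: measurable_pattern HD].
have -> : avg mass i \1_D = fun z => \sum_a mass a * (\1_[set z | D (upd z i a)] z : R).
  by apply/funext => z; apply: eq_bigr => a _; rewrite !indicE.
rewrite avgs_sum mulr_sumr; apply: eq_bigr => a _.
rewrite -setIA pattern_letter setIA (setIAC _ (pattern _)).
rewrite (cylinder_cons _ (phi @^-1` [set a]) isn).
have mA' := measurable_with_coord i (mphi a) mA.
rewrite (IH _ _ _ ul (supp_split HD a))//; last first.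
  move=> j jl; rewrite !inE negb_or ls ?inE ?jl ?orbT// andbT.
  by apply: contraNneq il => <-.
by rewrite -cylinder_cons// pr_cyl_cons// -mulrA mulrCA.
Qed.

Lemma pr_pattern (x0 : G -> W) l D : uniq l -> supp [in l] (\1_D : _ -> R) ->
  pr P (pattern D) = avgs mass l \1_D x0.
Proof.
move=> ul HD.
have cT : cylinder fset0 (fun=> setT) = [set: configs G R] by apply/seteqP; split.
have := pr_cyl_pattern x0 (s := fset0) (A := fun=> setT) ul HD.
by rewrite cT setTI {2}/pr probability_setT mul1r; apply.
Qed.

End fixed_alphabet.

Definition finitary (B : set (configs G R)) := exists (W : finType)
    (phi : unit_itv R -> W) (l : seq G) (D : set (G -> W)),
  [/\ forall a, measurable (phi @^-1` [set a]), uniq l,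
      supp [in l] (\1_D : _ -> R) & B = pattern phi D].

Lemma supp_indic (W : finType) (Q : pred G) (D : set (G -> W)) :
  (forall x y, (forall i, Q i -> x i = y i) -> D x -> D y) <-> supp Q (\1_D : _ -> R).
Proof.
split=> [H x y xy|H x y xy Dx].
  rewrite !indicE; congr (_%:R); congr nat_of_bool; apply/idP/idP => /set_mem Dz;
    apply/mem_set; move: Dz; apply: H => // i Qi; by rewrite xy.
have := H _ _ xy; rewrite !indicE (mem_set Dx).
case: (boolP (y \in D)) => [/set_mem//|_] /eqP.
by rewrite oner_eq0.
Qed.

Lemma finitary_measurable B : finitary B -> measurable B.
Proof. by move=> [W [phi [l [D [mphi _ HD ->]]]]]; exact: measurable_pattern mphi _ _ HD. Qed.

Lemma finitaryC B : finitary B -> finitary (~` B).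
Proof.
move=> [W [phi [l [D [mphi ul /supp_indic HD ->]]]]].
exists W, phi, l, (~` D); split => //; apply/supp_indic => x y xy Dx Dy.
by apply: Dx; move: Dy; apply: HD => i il; rewrite xy.
Qed.

(** The two events may use different alphabets, so their union is read over the product alphabet. *)
Lemma finitaryU B C : finitary B -> finitary C -> finitary (B `|` C).
Proof.
move=> [W [phi [l [D [mphi ul /supp_indic HD ->]]]]].
move=> [W' [phi' [l' [D' [mphi' ul' /supp_indic HD' ->]]]]].
exists (W * W')%type, (fun t => (phi t, phi' t)), (undup (l ++ l')),
  [set z : G -> W * W' | D (fst \o z) \/ D' (snd \o z)]; split => //.
- move=> [a a'].
  rewrite (_ : _ @^-1` _ = phi @^-1` [set a] `&` phi' @^-1` [set a']).
    exact: measurableI.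
  by apply/seteqP; split => x /= [-> ->].
- exact: undup_uniq.
- apply/supp_indic => x y xy [Dx|Dx]; [left; apply: HD Dx|right; apply: HD' Dx] => i il /=;
    by rewrite xy//= mem_undup mem_cat il ?orbT.
Qed.

Lemma finitary_coord i (B : set (unit_itv R)) : measurable B ->
  finitary [set x | B (x i)].
Proof.
move=> mB; exists bool, (fun t => `[< B t >]), [:: i], [set z : G -> bool | z i]; split => //.
- case.
    rewrite (_ : _ @^-1` _ = B)//.
    by apply/seteqP; split => t /= /asboolP.
  rewrite (_ : _ @^-1` _ = ~` B); first exact: measurableC.
  by apply/seteqP; split => t /=; [move=> /asboolPn|move=> nB; apply/asboolPn].
- by apply/supp_indic => x y xy /=; rewrite xy//= inE.
- by apply/seteqP; split => x /= /asboolP.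
Qed.

Lemma finitary_approx (B : set (configs G R)) (e : R) : measurable B -> 0 < e ->
  exists2 A, finitary A & pr P (B `+` A) < e.
Proof.
move=> mB e0; apply: approx_algebra e e0.
- exact: finitary_measurable.
- rewrite (_ : set0 = [set x : configs G R | set0 (x 1%g)])//.
  by apply: finitary_coord; exact: measurable0.
- exact: finitaryC.
- exact: finitaryU.
- move: B mB; apply: smallest_sub; first exact: smallest_sigma_algebra.
  move=> _ [i _ [B mB <-]]; apply: sub_sigma_algebra.
  by rewrite setTI; exact: finitary_coord.
Qed.

End patterns.

Lemma image_shift (G : groupType) (R : realType) (g : G) (B : set (configs G R)) :
  Defs.shift g @` B = Defs.shift (g^-1)%g @^-1` B.
Proof.
apply/seteqP; split => [_ [x Bx <-]|x Bx] /=.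
  by rewrite -shiftM mulVg shift1.
by exists (Defs.shift (g^-1)%g x); rewrite // -shiftM mulgV shift1.
Qed.

(** Replacing [B] by a nearby finitary event [C] brings [spectral_gap] to bear, with errors that can
    be made arbitrarily small. *)
Lemma bernoulli_rigidity (G : groupType) (R : realType)
    (P : probability (configs G R) R) (g : 'I_3 -> G) (T : 'I_3 -> set G) (c : R) :
  is_product_measure P -> pingpong g T ->
  (forall e : R, 0 < e -> exists B : set (configs G R), [/\ measurable B,
     `|c - pr P B| < e & forall j, `|c - pr P (Defs.shift (g j) @` B `&` B)| < e]) ->
  c - c ^+ 2 <= 0.
Proof.
move=> HP gT H.
have estimate (e t : R) : 0 < e -> 0 < t -> c - c ^+ 2 <= 2 * e + 6 * t + 9 * e / t.
  move=> e0 t0; have [B [mB Bc gBc]] := H e e0.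
  have [C [W [phi [l [D [mphi ul HD EC]]]]] BC] := finitary_approx P mB e0.
  have mC : measurable C by rewrite EC; exact: measurable_pattern mphi _ _ HD.
  have msh j (A : set (configs G R)) : measurable A ->
      measurable (Defs.shift ((g j)^-1)%g @^-1` A).
    by move=> mA; rewrite -[X in measurable X]setTI; exact: measurable_shift.
  have prsh j (A : set (configs G R)) : measurable A ->
      pr P (Defs.shift ((g j)^-1)%g @^-1` A) = pr P A.
    by move=> mA; rewrite /pr shift_preserves.
  (* [L] holds the coordinates of [u] and of all its translates. *)
  pose L := undup (l ++ flatten [seq map ( *%g (g j)) l | j <- enum 'I_3]).
  have lL : {subset l <= L} by move=> i il; rewrite mem_undup mem_cat il.
  have glL j i : i \in l -> (g j * i)%g \in L.
    move=> il; rewrite mem_undup mem_cat; apply/orP; right; apply/flatten_mapP.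
    by exists j; rewrite ?mem_enum//; exact: map_f.
  have uL : uniq L := undup_uniq _.
  pose x0 : G -> W := fun=> phi point.
  pose u : (G -> W) -> R := \1_D.
  have Hu : supp [in L] u by apply: sub_supp HD => i /lL.
  have b_eq := pr_pattern mphi HP x0 uL Hu; rewrite -EC in b_eq.
  pose gD j : set (G -> W) := [set y : G -> W | D (y \o *%g (g j))].
  have HgD j : supp [in L] (\1_(gD j `+` D) : _ -> R).
    move/supp_indic: HD => HD; apply/supp_indic => y z yz.
    have E1 : D y <-> D z by split; apply: HD => i /lL il; rewrite yz.
    have E2 : gD j y <-> gD j z.
      by split; apply: HD => i il /=; rewrite yz//; exact: glL.
    by rewrite !setY_def /=; tauto.
  have gC j : pattern phi (gD j `+` D) = (Defs.shift ((g j)^-1)%g @^-1` C) `+` C.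
    have E (x : configs G R) : Defs.shift ((g j)^-1)%g x = (fun h => x (g j * h)%g).
      by apply/funext => h; rewrite /Defs.shift invgK.
    by rewrite EC !setY_def; apply/seteqP; split => x; rewrite /pattern /gD /= E.
  (* Two errors [e] come from exchanging [C] for [B], and at most [4 * e] from
     [2 * (pr P B - pr P (gB & B))], where [gB] is the translate of [B] by [g j]. *)
  have dj j : pr P ((Defs.shift ((g j)^-1)%g @^-1` C) `+` C) <= 6 * e.
    have := prY_triangle P (msh j _ mC) (msh j _ mB) mC.
    have := prY_triangle P (msh j _ mB) mB mC.
    have -> : Defs.shift ((g j)^-1)%g @^-1` C `+` Defs.shift ((g j)^-1)%g @^-1` B =
              Defs.shift ((g j)^-1)%g @^-1` (B `+` C).
      by rewrite setYC !setY_def.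
    rewrite prsh; last exact: measurableY.
    have := gBc j; rewrite image_shift => gBcj.
    rewrite [pr P (_ `+` B)]prY//; last exact: msh.
    rewrite prsh// => h1 h2.
    move: Bc gBcj; rewrite !ltr_norml => /andP[? ?] /andP[? ?]; lra.
  have Hd j : avgs (mass P phi) L (fun y => (u (y \o *%g (g j)) - u y) ^+ 2) x0 <= 6 * e.
    apply: le_trans (dj j); rewrite -gC (pr_pattern mphi HP x0 uL (HgD j)).
    rewrite le_eqVlt; apply/orP; left; apply/eqP; congr avgs; apply/funext => y.
    rewrite /u !indicE setY_def.
    have -> : (y \in (gD j `\` D) `|` (D `\` gD j)) = (y \o *%g (g j) \in D) (+) (y \in D).
      have -> : ((y \o *%g (g j)) \in D) = (y \in gD j).
        by apply/idP/idP => /set_mem Dy; apply/mem_set.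
      rewrite in_setU !in_setD.
      by case: (y \in gD j); case: (y \in D).
    by case: (_ \in D); case: (_ \in D) => /=; rewrite ?subrr ?subr0 ?sub0r ?sqrrN ?expr0n ?expr1n.
  have := spectral_gap (sum_mass P mphi) (mass_ge0 P phi) gT ul uL lL glL HD _ t0 Hd (esym b_eq).
  have u01 y : u y = 0 \/ u y = 1.
    by rewrite /u indicE; case: (_ \in _); [right|left].
  move=> /(_ u01).
  have : `|pr P B - pr P C| < e.
    apply: le_lt_trans BC; rewrite prY//.
    have := le_pr P (measurableI _ _ mB mC) mB (@subIsetl _ _ _).
    have := le_pr P (measurableI _ _ mB mC) mC (@subIsetr _ _ _).
    by rewrite ler_norml => ? ?; apply/andP; split; lra.
  have := pr_ge0 P C; have := pr_le1 P mC.
  move: Bc; rewrite !ltr_norml; set b := pr P C; set b' := pr P B.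
  move=> /andP[? ?] b1 b0 /andP[? ?].
  have -> : 3 * (6 * e) / (2 * t) = 9 * e / t by field; rewrite gt_eqF.
  (* [b] is within [2 * e] of [c]. Passing from [b] to [c] increases [x - x ^ 2] by at most the
     distance, whichever of the two is larger. *)
  suff : c - c ^+ 2 <= b - b ^+ 2 + 2 * e by lra.
  have [bc|cb] := leP b c.
    have := mulr_ge0 b0 (_ : 0 <= c - b); rewrite subr_ge0 => /(_ bc).
    have := sqr_ge0 (c - b); nra.
  have : 0 <= (1 - b) * (b - c) by rewrite mulr_ge0 ?subr_ge0// ltW.
  have := sqr_ge0 (c - b); nra.
rewrite leNgt; apply/negP => v0.
(* With [e = t ^ 2] the estimate becomes [24 * t <= 2 * t ^ 2 + 15 * t <= 17 * t], impossible for
   [t > 0]. *)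
pose t := (c - c ^+ 2) / 24.
have t0 : 0 < t by rewrite divr_gt0.
have t1 : t <= 1 by rewrite /t; have := sqr_ge0 (c - 2^-1); nra.
have := estimate (t ^+ 2) t (exprn_gt0 2 t0) t0.
have -> : 9 * t ^+ 2 / t = 9 * t by field; rewrite gt_eqF.
have -> : c - c ^+ 2 = 24 * t by rewrite /t; field.
have : t ^+ 2 <= t by rewrite expr2 ler_piMl// ltW.
lra.
Qed.

(** * Ping-pong *)

Lemma pingpong_comp (G : groupType) n m (g : 'I_n -> G) T (f : 'I_m -> 'I_n) :
  injective f -> pingpong g T -> pingpong (g \o f) (T \o f).
Proof.
move=> fI [Td gT]; split => [i j _ _ ij|j h]; last exact: gT.
by apply: fI; exact: Td ij.
Qed.

Lemma pingpong_conj (G : groupType) n (g : 'I_n -> G) T (z : G) : pingpong g T ->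
  pingpong (fun j => z * g j * z^-1)%g (fun j => [set h | T j (z^-1 * h)%g]).
Proof.
move=> [Td gT]; split => [i j _ _ [h [/= ih jh]]|j h /= /gT].
  by apply: Td => //; exists (z^-1 * h)%g.
by rewrite !mulgA mulVg mul1g.
Qed.

Lemma pingpong_inv (G : groupType) n (g : 'I_n -> G) T j h : pingpong g T ->
  ~ T j h -> T j ((g j)^-1 * h)%g.
Proof.
move=> [_ gT] Th; apply: contra_notP Th => /gT.
by rewrite mulVKg.
Qed.

Lemma pingpong_nonempty (G : groupType) n (g : 'I_n -> G) T j :
  pingpong g T -> T j !=set0.
Proof.
move=> [_ gT]; have [T1|/gT T1] := pselect (T j 1%g); first by exists 1%g.
by exists (g j * 1)%g.
Qed.

(** The conjugates turn out to lie in [H], so left multiplication by them preserves each right coset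
    of [H], and each coset is a copy of [H]. *)
Lemma BP_pingpong (G : groupType) (gamma : G) n : property_BP G -> gamma <> 1%g ->
  (2 <= n)%N -> exists (alpha : 'I_n -> G) (T : 'I_n -> set G),
    pingpong (fun j => alpha j * gamma * (alpha j)^-1)%g T.
Proof.
move=> BP gamma1 n2; have [alpha [H [T [[H1 HV] TH Td gT]]]] := BP _ gamma1 n n2.
rewrite inE in H1; have {}HV u v : H u -> H v -> H (u / v)%g.
  by move=> Hu Hv; apply/set_mem; apply: HV; exact: mem_set.
have HI u : H u -> H u^-1%g by move=> Hu; rewrite -[u^-1%g]mul1g; exact: HV.
have HM u v : H u -> H v -> H (u * v)%g.
  by move=> Hu Hv; rewrite -[v]invgK; apply: HV => //; exact: HI.
pose g j := (alpha j * gamma * (alpha j)^-1)%g.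
have {}gT j h : H h -> ~ T j h -> T j (g j * h)%g by move=> Hh Th; apply: gT; exists h.
(* Since [n >= 2], some other [T k] is nonempty and disjoint from [T j], so some [h] in [H] lies
   outside [T j]; then [g j * h] and [h] are both in [H]. *)
have Hg j : H (g j).
  have [h [Hh Th]] : exists h, H h /\ ~ T j h.
    have [k kj] : exists k : 'I_n, k != j.
      have /card_gt1P[k [k' [_ _ kk']]] : (1 < #|'I_n|)%N by rewrite card_ord.
      by have [kj|] := eqVneq k j; [exists k'; rewrite eq_sym -kj|exists k].
    have [h Tkh] : T k !=set0.
      have [?|/(gT _ _ H1) ?] := pselect (T k 1%g); first by exists 1%g.
      by exists (g k * 1)%g.
    exists h; split; first exact: TH Tkh.
    by move=> Tjh; case/eqP: kj; apply: Td => //; exists h.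
  by rewrite -(mulgK h (g j)); apply: HV => //; apply: TH; exact: gT.
(* T is spread over all right cosets of H, with representatives r. *)
pose r x := xget 1%g [set z | H (x / z)%g].
have rP x : H (x / r x)%g.
  by apply: (@xgetPex _ 1%g [set z | H (x / z)%g]); exists x; rewrite /= divgg.
have rM h x : H h -> r (h * x)%g = r x.
  move=> Hh; congr xget; apply/seteqP; split => z /= Hz; last by rewrite -mulgA; exact: HM.
  by have := HM _ _ (HI _ Hh) Hz; rewrite -mulgA mulKg.
exists alpha, (fun j => [set x | T j (x / r x)%g]); split.
  by move=> i j _ _ [x [/= ix jx]]; apply: Td => //; exists (x / r x)%g.
by move=> j h /= /(gT j _ (rP h)); rewrite mulgA rM//; exact: Hg.
Qed.

(** Ping-pong for letters: [U l] attracts everything outside the set of the inverse letter. In a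
    reduced word the next letter is not the inverse of [l], so its attracting set avoids the one set
    that [l] does not control. *)
Lemma letter_pingpong (G : groupType) (U : G * bool -> set G) (S : set G) l w :
  (forall l h, S l.1 -> ~ U (l.1, ~~ l.2) h ->
     U l ((if l.2 then l.1 else l.1^-1) * h)%g) ->
  (forall l m h, S l.1 -> S m.1 -> U l h -> U m h -> l = m) ->
  word_over S (l :: w) -> reduced (l :: w) ->
  forall h, ~ U ((last l w).1, ~~ (last l w).2) h -> U l (word_val (l :: w) * h)%g.
Proof.
move=> Ul Ud; elim: w l => [|m w IH] l Sw red h /= Uh.
  by rewrite /word_val big_seq1; apply: Ul => //; apply: Sw; rewrite mem_head.
have Sl : S l.1 by apply: Sw; rewrite mem_head.
have Sm : S m.1 by apply: Sw; rewrite !inE eqxx orbT.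
move: red; rewrite /reduced /= => /andP[lm red].
rewrite /word_val big_cons -mulgA; apply: Ul => //.
have Um : U m (word_val (m :: w) * h)%g.
  by apply: IH => // l' l'w; apply: Sw; rewrite inE l'w orbT.
move=> /(Ud (l.1, ~~ l.2) m _ Sl Sm) /(_ Um) E.
by move: lm; rewrite -E /= eqxx; case: l.2.
Qed.

(** The [g j] may be involutions, so they are multiplied in pairs: [g i0 * g i1] sends the
    complement of [T i1] into [T i0], and its inverse sends the complement of [T i0] into [T i1]. *)
Lemma pingpong_free (G : groupType) (g : 'I_4 -> G) T (K : set G) :
  pingpong g T -> is_subgroup K -> (forall j, K (g j)) -> contains_nonabelian_free K.
Proof.
move=> gT [K1 KV] Kg; rewrite inE in K1.
have {}KV u v : K u -> K v -> K (u / v)%g.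
  by move=> Ku Kv; apply/set_mem; apply: KV; exact: mem_set.
have KI u : K u -> K u^-1%g by move=> Ku; rewrite -[u^-1%g]mul1g; exact: KV.
have KM u v : K u -> K v -> K (u * v)%g.
  by move=> Ku Kv; rewrite -[v]invgK; apply: KV => //; exact: KI.
have Td i j h : T i h -> T j h -> i = j.
  by move=> ih jh; apply: gT.1 => //; exists h.
pose i0 : 'I_4 := @Ordinal 4 0 isT.
pose i1 : 'I_4 := @Ordinal 4 1 isT.
pose i2 : 'I_4 := @Ordinal 4 2 isT.
pose i3 : 'I_4 := @Ordinal 4 3 isT.
pose x := (g i0 * g i1)%g.
pose y := (g i2 * g i3)%g.
have step i j h : i != j -> ~ T j h -> T i (g i * g j * h)%g.
  move=> ij Th; rewrite -mulgA; apply: gT.2 => Ti.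
  by case/eqP: ij; apply: Td Ti _; exact: gT.2.
have stepV i j h : i != j -> ~ T i h -> T j ((g i * g j)^-1 * h)%g.
  move=> ij Th; rewrite invgM -mulgA; apply: (pingpong_inv gT) => Tj.
  by case/eqP: ij; apply: Td Tj; exact: pingpong_inv gT _.
have xy : x <> y.
  move=> xy; have [h Th] := pingpong_nonempty i0 gT.
  have Tx : T i0 (x * h)%g.
    by apply: step => // Th'; have /eqP := Td _ _ _ Th Th'.
  have Ty : T i2 (y * h)%g.
    by apply: step => // Th'; have /eqP := Td _ _ _ Th Th'.
  by rewrite -xy in Ty; have /eqP := Td _ _ _ Tx Ty.
have yx : (y == x) = false by apply/eqP => /esym.
pose S : set G := [set x; y].
(* The index of the attracting set of a letter: [T i0], [T i1] for [x] and its inverse, [T i2],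
   [T i3] for [y] and its inverse. *)
pose idx (l : G * bool) := if l.1 == x then (if l.2 then i0 else i1)
                           else (if l.2 then i2 else i3).
have idx_inj l m : S l.1 -> S m.1 -> idx l = idx m -> l = m.
  by case: l m => [a b] [a' b'] /= [->|->] [->|->] /eqP; rewrite /idx /= ?eqxx ?yx;
    case: b; case: b'.
pose U l := T (idx l).
have Ul l h : S l.1 -> ~ U (l.1, ~~ l.2) h ->
    U l ((if l.2 then l.1 else l.1^-1) * h)%g.
  by case: l => [a []] /= [->|->]; rewrite /U /idx /= ?eqxx ?yx => Uh;
    [apply: step|apply: step|apply: stepV|apply: stepV].
have Ud l m h : S l.1 -> S m.1 -> U l h -> U m h -> l = m.
  by move=> Sl Sm lh mh; apply: idx_inj => //; exact: Td lh mh.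
have free w : word_over S w -> reduced w -> w <> [::] -> word_val w <> 1%g.
  case: w => // l w Sw red _ w1.
  pose m := idx ((last l w).1, ~~ (last l w).2).
  (* At least two of the four sets remain. A point of such a [T k] is moved by the word into
     [T (idx l)], which is disjoint from [T k], so the word is not the identity. *)
  have [k [kl km]] : exists k, k != idx l /\ k != m.
    suff /set0Pn[k] : finset.setC [set idx l; m]%SET != finset.set0.
      by rewrite !inE negb_or => /andP[]; exists k.
    rewrite -card_gt0 cardsCs finset.setCK card_ord subn_gt0.
    by rewrite cards2; case: (_ != _).
  have [h Th] := pingpong_nonempty k gT.
  have := letter_pingpong Ul Ud Sw red (h := h); rewrite w1 mul1g => H.
  case/eqP: kl; apply: (Td _ _ _ Th); apply: H => Uh.
  by case/eqP: km; exact: Td Th Uh.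
exists (@word_val G @` word_over S); split.
- move=> _ [w Sw <-]; rewrite /word_val; elim: w Sw => [|l w IH] Sw.
    by rewrite big_nil.
  rewrite big_cons; apply: (KM _ _); last by apply: IH => m mw; apply: Sw; rewrite inE mw orbT.
  have : S l.1 by apply: Sw; rewrite mem_head.
  have Kx : K x by exact: KM.
  have Ky : K y by exact: KM.
  by case: l.2 => -[->|->] //; exact: KI.
- by exists S.
- have Sxy b c l : l \in [:: (x, b); (y, c)] -> S l.1.
    by rewrite !inE => /orP[|] /eqP->; [left|right].
  have Kone a : S a -> (@word_val G @` word_over S) a.
    move=> Sa; exists [:: (a, true)]; last by rewrite /word_val big_seq1.
    by move=> l; rewrite inE => /eqP ->.
  exists x, y; split; [by apply: Kone; left|by apply: Kone; right|].
  (* If [x] and [y] commuted, the reduced word of their commutator would have value 1. *)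
  move=> xyC; apply: (free [:: (x, true); (y, true); (x, false); (y, false)]) => //.
  + move=> l; rewrite -[[:: _; _; _; _]]/([:: (x, true); (y, true)] ++ [:: (x, false); (y, false)]).
    by rewrite mem_cat => /orP[]; exact: Sxy.
  + have xy' : (x == y) = false by apply/eqP.
    by rewrite /reduced /= xy' yx.
  + rewrite /word_val !big_cons big_nil /= mulg1 mulgA xyC -invgM.
    by rewrite -[(y * x)%g]xyC; exact: mulgV.
Qed.

(** * Fixed points of actions *)

Definition separating d (X : measurableType d) (U : nat -> set X) :=
  (forall n, measurable (U n)) /\ forall x y, (forall n, U n x <-> U n y) -> x = y.

(** The sets are pulled back from balls around a dense sequence with radii [1 / (k + 1)]; the
    Hausdorff property makes them separate points. *)
Lemma standard_borel_separating (R : realType) d (X : measurableType d) :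
  standard_borel R X -> exists U : nat -> set X, separating U.
Proof.
move=> [Q [f [hQ [D cD dD] /bij_inj fI mE]]].
have [e De] : exists e : nat -> Q, D `<=` range e.
  case/pfcard_geP: cD => [D0|[e]].
    have [z [_]] := dD _ (ex_intro _ (f point) I) openT.
    by rewrite D0.
  by exists e => z Dz; have [n _ <-] := @surj _ _ _ _ e z Dz; exists n.
(* Balls need not be open; their interiors are, hence their preimages are measurable. *)
pose V (nk : nat * nat) := f @^-1` interior (ball (e nk.1) (nk.2.+1%:R^-1 : R)).
(* An index that codes no pair defaults to [(0, 0)], which merely repeats a set. *)
pose code (m : nat) : nat * nat := odflt (0, 0)%N (@pickle_inv (nat * nat)%type m).
have codeK nk : code (choice.pickle nk) = nk by rewrite /code pickleK_inv.
exists (V \o code); split.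
  move=> m; rewrite mE; exists (interior (ball (e (code m).1) ((code m).2.+1%:R^-1 : R))).
    by apply: sub_sigma_algebra; exact: open_interior.
  by rewrite setTI.
move=> x y xy; apply: fI; apply: contrapT => /eqP.
move: hQ; rewrite ball_hausdorff => /[apply] -[[r1 r2] /= /eqP/seteqP[r12 _]].
have [k kr] : exists k : nat, (k.+1%:R^-1 : R) < r1%:num / 2.
  have [k _ /(_ k (leqnn k))] :=
    near_infty_natSinv_lt (PosNum (divr_gt0 [gt0 of r1%:num] (ltr0Sn R 1))).
  by exists k.
have k0 : 0 < (k.+1%:R^-1 : R) / 2 by rewrite divr_gt0// invr_gt0.
have [z [zx /De[n _ zn]]] := dD _ (ex_intro _ (f x) (nbhsx_ballx (f x) _ k0)) (open_interior _).
have {}zx : ball (f x) (k.+1%:R^-1 / 2 : R) z by exact: interior_subset zx.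
have Vx : V (n, k) x.
  rewrite /V /= zn; apply: filterS (nbhsx_ballx (f x) _ k0) => t xt.
  by rewrite [k.+1%:R^-1]splitr; apply: ball_triangle xt; exact: ball_sym.
have Vy : V (n, k) y by have := xy (choice.pickle (n, k)); rewrite /= codeK => -[/(_ Vx)].
apply: (r12 (f y)); split; last exact: ballxx.
have zy : ball z (k.+1%:R^-1 : R) (f y) by rewrite -zn; exact: interior_subset Vy.
have := ball_triangle zx zy; apply: le_ball.
by have : 0 < r1%:num by []; move: kr; set v := _^-1; lra.
Qed.

(** A point lies in [n * c > k] of the sets on average, so with positive probability in more than
    [k]. Sorting points by the exact set of indices [F x] leaves finitely many cases, one of which
    has positive measure. *)
Lemma pr_many_meet (R : realType) d (T : measurableType d) (P : probability T R)
    n k (A : 'I_n -> set T) (c : R) :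
  (forall j, measurable (A j)) -> (forall j, pr P (A j) = c) -> k%:R < n%:R * c ->
  exists2 f : 'I_k.+1 -> 'I_n, injective f & 0 < pr P (\bigcap_i A (f i)).
Proof.
move=> mA Ac kc.
pose F x : {set 'I_n} := [set j | x \in A j]%SET.
have mF (S : {set 'I_n}) : measurable [set x | F x = S].
  have -> : [set x | F x = S] =
      \bigcap_(j in [set: 'I_n]) (if j \in S then A j else ~` A j).
    apply/seteqP; split => x /=.
      move=> <- j _; rewrite inE; case: ifPn => [/set_mem//|nA Ax].
      by rewrite mem_set in nA.
    move=> H; apply/setP => j; rewrite inE; have := H j I.
    by case: ifPn => _ Ax; [exact: mem_set|apply/negbTE/negP => /set_mem].
  by apply: fin_bigcap_measurable => // j _; case: ifP => _; [|exact: measurableC].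
pose q (S : {set 'I_n}) := pr P [set x | F x = S].
have q1 : \sum_S q S = 1.
  rewrite (_ : 1 = pr P setT); last by rewrite /pr probability_setT.
  rewrite (pr_partition P measurableT mF).
  by apply: eq_bigr => S _; rewrite setTI.
have prA j : pr P (A j) = \sum_(S : {set 'I_n}) (j \in S)%:R * q S.
  rewrite (pr_partition P (mA j) mF); apply: eq_bigr => S _.
  case: (boolP (j \in S)) => jS.
    rewrite mul1r; congr pr; apply/seteqP; split => x /=; first by case.
    by move=> FS; split => //; move: jS; rewrite -FS inE => /set_mem.
  rewrite mul0r (_ : _ `&` _ = set0) ?pr0//; apply/seteqP; split => x //= -[Ax FS].
  by move: jS; rewrite -FS inE mem_set.
have [S kS qS] : exists2 S : {set 'I_n}, (k < #|S|)%N & 0 < q S.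
  apply: contrapT => N; move: kc; apply/negP; rewrite -leNgt.
  have -> : n%:R * c = \sum_j pr P (A j).
    under eq_bigr do rewrite Ac.
    by rewrite sumr_const card_ord mulr_natl.
  under eq_bigr do rewrite prA.
  have -> : k%:R = \sum_(S : {set 'I_n}) k%:R * q S by rewrite -mulr_sumr q1 mulr1.
  rewrite exchange_big /=; apply: ler_sum => S _; rewrite -mulr_suml -natr_sum.
  have -> : (\sum_(j < n) (j \in S) = #|S|)%N.
    by rewrite -sum1_card [RHS]big_mkcond; apply: eq_bigr => j _; case: (j \in S).
  have [kS|Sk] := ltnP k #|S|; last by rewrite ler_wpM2r ?pr_ge0// ler_nat.
  have [q0|] := ltP 0 (q S); first by case: N; exists S.
  by move=> q0; have -> : q S = 0 by [apply/eqP; rewrite eq_le q0 pr_ge0]; rewrite !mulr0.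
exists (fun i => enum_val (widen_ord kS i)).
  by move=> i i' /enum_val_inj/(congr1 val) /= ii'; exact: val_inj.
apply: lt_le_trans qS _; apply: le_pr => //.
  by apply: fin_bigcap_measurable.
move=> x /= FS i _; apply: set_mem; move: (enum_val _) (enum_valP (widen_ord kS i)) => j.
by rewrite -FS finset.in_set.
Qed.

Section fixed_points.
Context (G : groupType) (R : realType) d (X : measurableType d)
  (mu : probability X R) (a : mp_action G mu).

Definition fixed (g : G) : set X := [set x | a g x = x].

Lemma actK g x : a g^-1%g (a g x) = x.
Proof. by rewrite -actM mulVg act1. Qed.

Lemma actKV g x : a g (a g^-1%g x) = x.
Proof. by rewrite -actM mulgV act1. Qed.

Lemma measurable_act_preimage g (A : set X) : measurable A -> measurable (a g @^-1` A).
Proof. by move=> mA; rewrite -[X in measurable X]setTI; exact: measurable_act. Qed.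

Lemma fixed_conj z g : fixed (z * g * z^-1)%g = a z^-1%g @^-1` fixed g.
Proof.
apply/seteqP; split => x /=; rewrite /fixed /= !actM.
  by move=> {2}<-; rewrite actK.
by move=> ->; rewrite actKV.
Qed.

Lemma stabilizer_subgroup x : is_subgroup (stabilizer a x).
Proof.
split; first by apply/mem_set; exact: act1.
move=> u v /set_mem ux /set_mem vx; apply/mem_set; rewrite /stabilizer /=.
by rewrite actM -{1}vx actK.
Qed.

Hypothesis X_std : standard_borel R X.

(** A point is fixed exactly when no set of a separating sequence distinguishes it from its
    image. *)
Lemma measurable_fixed g : measurable (fixed g).
Proof.
have [U [mU sU]] := standard_borel_separating X_std.
have -> : fixed g = \bigcap_n ((a g @^-1` U n `&` U n) `|` (~` (a g @^-1` U n) `&` ~` U n)).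
  apply/seteqP; split => [x /= gx n _|x H].
    by rewrite /= gx; have [?|?] := pselect (U n x); [left|right].
  by apply: sU => n; have := H n I; rewrite /=; tauto.
apply: bigcapT_measurable => n; have mgU := measurable_act_preimage g (mU n).
by apply: measurableU; apply: measurableI => //; exact: measurableC.
Qed.

Lemma fixed_pingpong gamma k : property_BP G -> gamma <> 1%g -> mu (fixed gamma) != 0%E ->
  exists (g : 'I_k.+1 -> G) T, pingpong g T /\ 0 < pr mu (\bigcap_j fixed (g j)).
Proof.
move=> BP gamma1 fix0.
have mfix := measurable_fixed gamma.
have c0 : 0 < pr mu (fixed gamma).
  by rewrite lt0r pr_ge0 andbT; apply: contra fix0 => /eqP c0; rewrite (prE mu mfix) c0.
(* Conjugates have fixed sets of the same measure [c], so [n > k / c] of them suffice; the two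
   successors also secure [n >= 2] for property (BP). *)
pose n := (Num.bound (k%:R / pr mu (fixed gamma))).+2.
have [alpha [T gT]] := BP_pingpong BP gamma1 (isT : (2 <= n)%N).
have [|||f fI fpos] := @pr_many_meet _ _ _ mu n k
    (fun j => fixed (alpha j * gamma * (alpha j)^-1)%g) (pr mu (fixed gamma)).
- by move=> j; exact: measurable_fixed.
- by move=> j; rewrite fixed_conj /pr act_preserves.
- rewrite -ltr_pdivrMr//; apply: lt_le_trans (archi_boundP _) _.
    by rewrite divr_ge0// pr_ge0.
  by rewrite ler_nat; exact: leqW.
exists ((fun j => alpha j * gamma * (alpha j)^-1)%g \o f), (T \o f).
by split => //; exact: pingpong_comp.
Qed.

(** For each separating set, [V n] is it or its complement, whichever has measure 1. The
    intersection of the [V n] has measure 1, and by separation it is a single point. *)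
Lemma zero_one_trivial :
  (forall A, measurable A -> pr mu A = 0 \/ pr mu A = 1) -> is_trivial a.
Proof.
move=> H01; have [U [mU sU]] := standard_borel_separating X_std.
pose V n := if pr mu (U n) == 1 then U n else ~` U n.
have mV n : measurable (V n) by rewrite /V; case: ifP => // _; exact: measurableC.
have V0 n : mu.-negligible (~` V n).
  apply/negligible_pr; first exact: measurableC.
  rewrite prC// /V; case: ifP => [/eqP->|]; first by rewrite subrr.
  by case: (H01 _ (mU n)) => E; rewrite ?E ?eqxx// prC// E subr0 subrr.
have null := negligible_bigcup V0.
have [x0 Vx0] : exists x, forall n, V n x.
  apply: contrapT => N; have : mu.-negligible [set: X].
    apply: negligibleS null => x _; apply: contrapT => Nx; apply: N; exists x => n.
    by apply: contrapT => Vx; apply: Nx; exists n.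
  by move/(negligible_pr _ measurableT)/eqP; rewrite /pr probability_setT oner_eq0.
have only x : x <> x0 -> (\bigcup_n ~` V n) x.
  move=> xx0; apply: contrapT => Nx; apply: xx0; apply: sU => n.
  have Vx : V n x by apply: contrapT => Vx; apply: Nx; exists n.
  by move: Vx (Vx0 n); rewrite /V; case: ifP => _ /=; tauto.
exists x0 => A mA; rewrite diracE; case: (boolP (x0 \in A)) => [/set_mem|/negP] Ax0.
  suff : pr mu (~` A) = 0 by rewrite prC// prE// => /eqP; rewrite subr_eq0 => /eqP <-.
  apply/(negligible_pr _ (measurableC mA)).
  by apply: negligibleS null => x Ax; apply: only => xx0; apply: Ax; rewrite xx0.
suff : pr mu A = 0 by rewrite prE// => ->.
apply/(negligible_pr _ mA); apply: negligibleS null => x Ax; apply: only => xx0.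
by apply: Ax0; rewrite mem_set// -xx0.
Qed.

End fixed_points.

(** * Fixed sets under weak containment in the Bernoulli shift *)

Lemma contained_fixed_zero_one (G : groupType) (R : realType)
    (P : probability (configs G R) R) (HP : is_product_measure P)
    d (X : measurableType d) (mu : probability X R) (a : mp_action G mu)
    (g : 'I_3 -> G) T (A : set X) :
  weakly_contained a (bernoulli_shift HP) -> pingpong g T -> measurable A ->
  (forall j, A `<=` fixed a (g j)) -> pr mu A = 0 \/ pr mu A = 1.
Proof.
move=> wc gT mA fA.
have : pr mu A - pr mu A ^+ 2 <= 0.
  apply: (bernoulli_rigidity HP gT) => e e0.
  (* The element 1 controls the measure of [B] itself; each [g j] fixes [A] pointwise, so [A] meets
     its translate in all of [A]. *)
  have [||B [mB AB]] := wc 1%N (fun=> A) (1%g |` range g) e _ _ e0.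
  - by [].
  - by rewrite finite_setU; split; [exact: finite_set1|exact: finite_image].
  have gA h : (forall x, A x -> a h x = x) -> a h @` A `&` A = A.
    move=> hA; apply/seteqP; split => x; first by case.
    by move=> Ax; split => //; exists x => //; exact: hA.
  have s1 : bernoulli_shift HP 1%g @` B ord0 = B ord0.
    by rewrite -[RHS]image_id; apply: eq_imagel => x _; exact: shift1.
  exists (B ord0); split; first exact: mB.
    have := AB 1%g (or_introl erefl) ord0 ord0.
    rewrite gA; last by move=> x _; exact: act1.
    by rewrite s1 setIid.
  move=> j; have := AB (g j) (or_intror (ex_intro2 _ _ j I erefl)) ord0 ord0.
  by rewrite gA// => x; exact: fA.
have := pr_ge0 mu A; have := pr_le1 mu mA; set c := pr mu A => c1 c0 cc.
have : c * (1 - c) = 0 by nra.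
by move=> /eqP; rewrite mulf_eq0 subr_eq0 => /orP[/eqP|/eqP]; [left|right].
Qed.

Theorem theorem5p6 (R : realType) (G : groupType)
  (countable_G : countable [set: G]) (BP_G : property_BP G) :
  (forall (d : measure_display) (Y : measurableType d) (nu : probability Y R)
     (Y_standard : standard_borel R Y) (a : mp_action G nu),
     ergodic a -> ~ is_free a ->
     {ae nu, forall y, contains_nonabelian_free (stabilizer a y)}) /\
  shift_minimal G R.
Proof.
split.
  move=> d Y nu std a erg nonfree.
  have [gamma [gamma1 fix0]] : exists gamma, gamma <> 1%g /\ nu (fixed a gamma) != 0%E.
    apply: contrapT => N; apply: nonfree => g g1; apply/eqP; apply: contrapT => /negP g0.
    by apply: N; exists g.
  have [g [T [gT pos]]] := fixed_pingpong std 3 BP_G gamma1 fix0.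
  set A := \bigcap_j _ in pos.
  have mA : measurable A.
    by apply: fin_bigcap_measurable => // j _; exact: measurable_fixed.
  (* The points whose orbit meets [A]: an invariant set, measurable because the group is
     countable. *)
  pose Z := \bigcup_h (a h @^-1` A).
  have mZ : measurable Z.
    by apply: countable_bigcupT_measurable => // h; exact: measurable_act_preimage.
  have invZ h : a h @^-1` Z = Z.
    apply/seteqP; split => x [k _ /= Ak]; first by exists (k * h)%g => //=; rewrite actM.
    by exists (k / h)%g => //=; rewrite actM actK.
  have Z1 : nu Z = 1%E.
    case: (erg _ mZ invZ) => // Z0.
    have AZ : A `<=` Z by move=> x Ax; exists 1%g => //=; rewrite act1.
    by have := le_pr nu mA mZ AZ; rewrite {2}/pr Z0 leNgt pos.
  exists (~` Z); split; first exact: measurableC.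
    by rewrite probability_setC// Z1 subee.
  move=> y /=; apply: contra_not => -[h _ /= Ah].
  (* If [a h y] is fixed by the [g j], then [y] is fixed by their conjugates by [h^-1], which again
     play ping-pong. *)
  have := pingpong_conj h^-1%g gT => /pingpong_free; apply; first exact: stabilizer_subgroup.
  move=> j; have := Ah j I; rewrite /fixed /stabilizer /= invgK !actM => ->.
  by rewrite actK.
move=> P HP d X mu std a nontriv wc gamma gamma1.
apply/eqP; apply: contrapT => /negP fix0; apply: nontriv.
have [g [T [gT pos]]] := fixed_pingpong std 2 BP_G gamma1 fix0.
set A := \bigcap_j _ in pos.
have mA : measurable A.
  by apply: fin_bigcap_measurable => // j _; exact: measurable_fixed.
have H01 C : measurable C -> C `<=` A -> pr mu C = 0 \/ pr mu C = 1.
  move=> mC CA; apply: (contained_fixed_zero_one wc gT mC) => j x /CA; exact.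
apply: zero_one_trivial => // C mC.
(* [A] has positive measure and obeys the 0-1 law itself, so it has measure 1 and what lies outside
   it can be discarded. *)
have prC : pr mu C = pr mu (C `&` A).
  rewrite (prDI mu mC mA) [X in X + _](_ : _ = 0) ?add0r//.
  apply/eqP; rewrite eq_le pr_ge0 andbT.
  have A1 : pr mu A = 1 by case: (H01 A mA) => // A0; rewrite A0 ltxx in pos.
  have := le_pr mu (measurableD mC mA) (measurableC mA) (@subIsetr _ _ _).
  by rewrite prC// A1 subrr.
rewrite prC; apply: H01; last exact: subIsetr.
exact: measurableI.
Qed.
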